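(* Let $0<q<1$, $M\ge1$, $\vec k=(k_1,\dots,k_M)$ with all $k_j>0$, $s,t>-1$, and $v\in\mathbb{C}$ with $|\mathrm{Re}(v)+1|<2+s+t$. Then for all $\vec y,\vec y\,'\in(\mathbb{Z}_{\ge0})^M$, $$\sum_{x_1=0}^\infty\cdots\sum_{x_M=0}^\infty P_{\mathrm r}(\vec x,\vec y;s,t,v,\vec k)\,\overline{P_{\mathrm r}(\vec x,\vec y\,';s,t,-\overline v-2,\vec k)}\,W_{\vec k}(\vec x,s)=\frac{\delta_{\vec y,\vec y\,'}}{W_{\vec k}(\vec y,t)},$$ and for all $\vec x,\vec x\,'\in(\mathbb{Z}_{\ge0})^M$, $$\sum_{y_1=0}^\infty\cdots\sum_{y_M=0}^\infty P_{\mathrm r}(\vec x,\vec y;s,t,v,\vec k)\,\overline{P_{\mathrm r}(\vec x\,',\vec y;s,t,-\overline v-2,\vec k)}\,W_{\vec k}(\vec y,t)=\frac{\delta_{\vec x,\vec x\,'}}{W_{\vec k}(\vec x,s)}.$$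
   Context: $q^z=e^{z\log q}$; $(\alpha;p)_n=\prod_{i=0}^{n-1}(1-\alpha p^i)$, $(\alpha_1,\dots,\alpha_m;p)_n=\prod_i(\alpha_i;p)_n$, $(\alpha;p)_\infty=\lim_{n\to\infty}(\alpha;p)_n$ for $0<p<1$. For $k>0$ and $n,x\in\mathbb{Z}_{\ge0}$, $$\phi_{u,s}(n,x;k)=q^{n(s-u+\frac12k+\frac12)}\sum_{j=0}^{\min(n,x)}\frac{(q^{2n},\,q^{2x},\,q^{-2x-2s-2k};q^{-2})_j}{(q^{-2k},\,q^{-2};q^{-2})_j}q^{-2j},\qquad w_k(n)=q^{-n(k-1)}\frac{(q^{2k};q^2)_n}{(q^2;q^2)_n},$$ $$W_k(x,s)=\frac{1-q^{4x+2s+2k}}{1-q^{2x+2s+2k}}\,\frac{(q^{2k};q^2)_x}{(q^2;q^2)_x}\,\frac{(q^{2x+2s+2};q^2)_\infty}{(q^{2x+2s+2k+2};q^2)_\infty}\,q^{2x(x+s)}$$ (for $x=0$ the first fraction is read as $1$). Height function: $h'_j(\vec y,t)=t+\sum_{i=1}^j(2y_i+k_i)$, $h'_0(\vec y,t)=t$. Multivariate functions: $$\Phi_{v,t}(\vec n,\vec y)=\prod_{j=1}^M\phi_{v,h'_{j-1}(\vec y,t)}(n_j,y_j;k_j),\quad w_{\vec k}(\vec n)=\prod_{j=1}^Mw_{k_j}(n_j),\quad W_{\vec k}(\vec x,s)=\prod_{j=1}^MW_{k_j}\big(x_j,h'_{j-1}(\vec x,s)\big),$$ $$P_{\mathrm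 r}(\vec x,\vec y;s,t,v,\vec k)=\sum_{\vec n\in(\mathbb{Z}_{\ge0})^M}\Phi_{1,s}(\vec n,\vec x)\,\Phi_{v,t}(\vec n,\vec y)\,w_{\vec k}(\vec n),$$ which converges absolutely for $\mathrm{Re}(v)<1+s+t$ (the condition $|\mathrm{Re}(v)+1|<2+s+t$ says this holds for both $v$ and $-\overline v-2$). *)

(* Defs.v *)
From mathcomp Require Import all_boot all_order all_algebra.
From mathcomp Require Import complex.
From mathcomp Require Import all_classical all_reals all_analysis.
From mathcomp Require summability.

Set Implicit Arguments.
Unset Strict Implicit.
Unset Printing Implicit Defensive.

Import Order.TTheory GRing.Theory Num.Theory.
Import numFieldNormedType.Exports.

Local Open Scope classical_set_scope.
Local Open Scope ring_scope.
Local Open Scope complex_scope.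

Section QSpecialFunctions.
Variable R : realType.

Definition cexp (z : R[i]) : R[i] :=
  (expR (complex.Re z))%:C * (cos (complex.Im z) +i* sin (complex.Im z)).

(* q ^ z = e ^ (z log q); for real exponents the library's powR is used. *)
Definition cpow (q : R) (z : R[i]) : R[i] := cexp (z * (ln q)%:C).

Definition qpoch (a p : R) (n : nat) : R := \prod_(i < n) (1 - a * p ^+ i).

Definition qpoch_inf (a p : R) : R := lim (qpoch a p @ \oo).

Definition phi (q : R) (u : R[i]) (s k : R) (n x : nat) : R[i] :=
  cpow q (n%:R * (s%:C - u + (k / 2 + 1 / 2)%:C)) *
  (\sum_(j < (minn n x).+1)
     (qpoch (q ^+ (2 * n)) (q ^- 2) j * qpoch (q ^+ (2 * x)) (q ^- 2) j *
      qpoch (q `^ (- 2 * x%:R - 2 * s - 2 * k)) (q ^- 2) j) /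
     (qpoch (q `^ (- 2 * k)) (q ^- 2) j * qpoch (q ^- 2) (q ^- 2) j) *
     q ^- (2 * j))%:C.

Definition wk (q k : R) (n : nat) : R :=
  q `^ (- n%:R * (k - 1)) *
  (qpoch (q `^ (2 * k)) (q ^+ 2) n / qpoch (q ^+ 2) (q ^+ 2) n).

(* The case x = 0 is separate because 2 * s + 2 * k may vanish. *)
Definition Wk (q k : R) (x : nat) (s : R) : R :=
  (if x == 0%N then 1
   else (1 - q `^ (4 * x%:R + 2 * s + 2 * k)) /
        (1 - q `^ (2 * x%:R + 2 * s + 2 * k))) *
  (qpoch (q `^ (2 * k)) (q ^+ 2) x / qpoch (q ^+ 2) (q ^+ 2) x) *
  (qpoch_inf (q `^ (2 * x%:R + 2 * s + 2)) (q ^+ 2) /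
   qpoch_inf (q `^ (2 * x%:R + 2 * s + 2 * k + 2)) (q ^+ 2)) *
  q `^ (2 * x%:R * (x%:R + s)).

Section Multivariate.
Variable M : nat.
Implicit Types (k : 'I_M -> R) (n x y : M.-tuple nat).

(* The index i : 'I_M stands for the 1-based index i + 1, so the factor
   numbered j : 'I_M in the products below uses height _ _ _ j. *)
Definition height k y (t : R) (j : nat) : R :=
  t + \sum_(i < M | (i < j)%N) (2 * (tnth y i)%:R + k i).

Definition Phi (q : R) (v : R[i]) (t : R) k n y : R[i] :=
  \prod_(j < M) phi q v (height k y t j) (k j) (tnth n j) (tnth y j).

Definition wvec (q : R) k n : R := \prod_(j < M) wk q (k j) (tnth n j).

Definition Wvec (q : R) k x (s : R) : R :=
  \prod_(j < M) Wk q (k j) (tnth x j) (height k x s j).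

(* Unordered sum over all multi-indices (limit along finite subsets). *)
Definition Pr (q : R) x y (s t : R) (v : R[i]) k : R[i] :=
  summability.sum (fun n : M.-tuple nat =>
    (Phi q 1 s k n x * Phi q v t k n y * (wvec q k n)%:C : R[i]^o)).

End Multivariate.

(* is_itersum f l: the iterated series sum_{x_1} ... sum_{x_M} f (x_1, ..., x_M)
   (innermost sum over the last coordinate) converges at each stage and its
   value is l. *)
Fixpoint is_itersum (M : nat) : (M.-tuple nat -> R[i]) -> R[i] -> Prop :=
  match M with
  | 0 => fun f l => f [tuple] = l
  | M'.+1 => fun f l =>
      exists2 g : nat -> R[i],
        (forall a, is_itersum (fun x : M'.-tuple nat => f [tuple of a :: x])
                              (g a)) &
        (series g : nat -> R[i]^o) @ \oo --> (l : R[i]^o)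
  end.

End QSpecialFunctions.

(* Main.v *)
(* One variable. With p = q^2, the functions phi_{0,s}(n,x) are, up to powers of q,
   little q-Jacobi polynomials of degree x in the variable X = p^n. They are
   orthogonal with respect to w_k, with squared norm 1/W_k(x,s), and, since the point
   masses at the nodes p^n are limits of polynomials, they are also complete: the
   matrix phi_{0,s}(n,x) (w_k(n) W_k(x,s))^(1/2) is unitary. Writing z = v + 1,
   P_r(x,y) is the kernel K_z(x,y;s,t) = sum_n q^(-nz) phi_{0,s}(n,x) phi_{0,t}(n,y) w_k(n),
   and expanding twice gives
     sum_x K_z(x,y;s,t) K_{-z}(x,y';s,t') W_k(x,s) = sum_n phi_{0,t}(n,y) phi_{0,t'}(n,y') w_k(n),
   which is delta_{y,y'}/W_k(y,t) for t = t'. As q^(-nz) phi_{0,t}(n,y) need not be square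
   summable, the interchange of sums rests on explicit bounds giving absolute convergence.

   Several variables. P_r is the product of the kernels K_z taken at the heights. The
   one-variable sum above does not depend on s, so the iterated sum factors, also when
   y <> y' and the heights of y and y' differ; the factor at the first index where y and
   y' differ, where the heights still agree, vanishes. The second relation follows by the
   symmetry of K_z in (x,s) and (y,t). *)

Require Import Defs.
From mathcomp Require Import all_boot all_order all_algebra.
From mathcomp Require Import complex finmap ring lra zify.
From mathcomp Require Import all_classical all_reals all_analysis.

Set Implicit Arguments.
Unset Strict Implicit.
Unset Printing Implicit Defensive.

Import Order.TTheory GRing.Theory Num.Theory.
Import numFieldNormedType.Exports.

Local Open Scope ring_scope.
Local Open Scope complex_scope.

(** * q-Pochhammer symbols and q-differences *)

(** The obstacle is domination of the sums over [x]. If [|u_n| <= C A^n] with [a p <= A < 1], then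
    the sum of [u_n] against the polynomial of degree [x] at the nodes is bounded by a constant
    times [A^x p^(-x(x+1)/2) a^(-x)], while the dual weight is at most a constant times
    [p^(x^2) a^x]. For two such sums with rates [A] and [B] the quadratic exponents cancel exactly,
    and the series over [x] is dominated by a geometric one of ratio [A B / (a p)]. For the kernels
    [A = q^(s+t+2-Re z)], [B = q^(s+t'+2+Re z)] and [a p = q^(2s+2)], so that [A B < a p] reads
    [t + t' + 2 > 0]: the growth of one factor is compensated by the decay of the other, whatever
    [z] is. From [s > -1] only [a p < 1] follows; [a], and even [a c], may exceed 1. For this reason
    [x = 0] is often treated apart. Polynomials and weights are real, and [q^(-nz)] is the only
    complex factor. It is split into real and imaginary parts, so the analysis of series stays real
    up to the kernel. *)

Section QPochhammer.
Context {R : realType}.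
Implicit Types (a b p x : R) (j m n : nat).

Lemma qpoch0 a p : qpoch a p 0 = 1.
Proof. by rewrite /qpoch big_ord0. Qed.

Lemma qpochS a p n : qpoch a p n.+1 = qpoch a p n * (1 - a * p ^+ n).
Proof. by rewrite /qpoch big_ord_recr. Qed.

Lemma qpochD a p m n : qpoch a p (m + n) = qpoch a p m * qpoch (a * p ^+ m) p n.
Proof.
elim: n => [|n IH]; first by rewrite addn0 qpoch0 mulr1.
by rewrite addnS !qpochS IH exprD !mulrA.
Qed.

Lemma qpochSl a p n : qpoch a p n.+1 = (1 - a) * qpoch (a * p) p n.
Proof. by rewrite -add1n qpochD expr1 qpochS qpoch0 expr0 mulr1 mul1r. Qed.

Section Base.
Variable p : R.
Hypotheses (p_gt0 : 0 < p) (p_lt1 : p < 1).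

Let p_neq0 : p != 0. Proof. by rewrite gt_eqF. Qed.

Lemma exp_le1 j : p ^+ j <= 1.
Proof. by rewrite exprn_ile1 // ltW. Qed.

Lemma factor_gt0 a j : a < 1 -> 0 < 1 - a * p ^+ j.
Proof.
move=> a1; rewrite subr_gt0; have := exp_le1 j; have := exprn_gt0 j p_gt0.
have [a0|a0] := lerP a 0; first by move=> h _; apply: le_lt_trans ltr01; nra.
by move=> h1 h2; apply: le_lt_trans a1; rewrite ger_pMr.
Qed.

Lemma qpoch_gt0 a n : a < 1 -> 0 < qpoch a p n.
Proof. by move=> a1; apply: prodr_gt0 => i _; apply: factor_gt0. Qed.

Lemma qpoch_neq0 a n : a < 1 -> qpoch a p n != 0.
Proof. by move=> a1; rewrite gt_eqF ?qpoch_gt0. Qed.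

Lemma qpoch_le1 a n : 0 <= a -> a < 1 -> qpoch a p n <= 1.
Proof.
move=> a0 a1; apply: prodr_ile1 => i _; rewrite ltW ?factor_gt0//=.
by rewrite gerBl mulr_ge0 // exprn_ge0 // ltW.
Qed.

Lemma qpoch_zero m n : (m < n)%N -> qpoch (p ^- m) p n = 0.
Proof.
by move=> mn; rewrite /qpoch (bigD1 (Ordinal mn)) //= mulVf ?subrr ?mul0r ?expf_neq0.
Qed.

(* The product of the operators [1 - p^-i T], [i < n], with [T] the shift of [j]; each
   factor kills the sequence [p^(i j)], hence the product kills every polynomial
   of degree less than [n] in [p^j]. *)
Fixpoint qdiff n (f : nat -> R) : nat -> R :=
  if n is n'.+1 then fun j => qdiff n' f j - p ^- n' * qdiff n' f j.+1 else f.

(** These weights are the ones left from the coefficients of [jacobi x] after the summation over the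
    nodes, so a terminating sum of that kind is a q-difference of order [x] taken at 0. *)
Lemma qdiffE n f m : qdiff n f m =
  \sum_(j < n.+1) qpoch (p ^- n) p j / qpoch p p j * p ^+ j * f (m + j)%N.
Proof.
have pn1 j : 1 - p * p ^+ j != 0 by rewrite gt_eqF ?factor_gt0.
elim: n m => [|n IH] m.
  by rewrite big_ord1 /= !qpoch0 addn0 expr0 divr1 !mul1r.
(* The q-analogue of Pascal's rule for the coefficients of the product of operators. *)
have rec j : qpoch (p ^- n.+1) p j.+1 / qpoch p p j.+1 * p ^+ j.+1 =
   qpoch (p ^- n) p j.+1 / qpoch p p j.+1 * p ^+ j.+1
   - p ^- n * (qpoch (p ^- n) p j / qpoch p p j * p ^+ j).
  have pn0 : p ^+ n != 0 by rewrite expf_neq0.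
  have qn0 : qpoch p p j != 0 by apply: qpoch_neq0.
  rewrite [qpoch (p ^- n.+1) _ _]qpochSl (_ : p ^- n.+1 * p = p ^- n); last first.
    by rewrite exprS; field; apply/andP.
  rewrite !qpochS !exprS.
  by field; rewrite pn0 p_neq0 qn0 pn1.
rewrite /= !IH [RHS]big_ord_recl /=.
under [in RHS]eq_bigr do rewrite /bump /= add1n rec mulrBl -!mulrA.
rewrite sumrB mulr_sumr addrA; congr (_ - _); last first.
  by apply: eq_bigr => j _; rewrite !addSn !addnS !mulrA.
rewrite [in RHS]big_ord_recr /= (qpoch_zero (ltnSn n)) mul0r addr0.
rewrite big_ord_recl /= !qpoch0; congr (_ + _).
by apply: eq_bigr => j _; rewrite /bump /= add1n !mulrA.
Qed.

Lemma qdiff_exp n r m :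
  qdiff n (fun j => (p ^+ r) ^+ j) m = (p ^+ r) ^+ m * \prod_(i < n) (1 - p ^+ r / p ^+ i).
Proof.
elim: n m => [|n IH] m; first by rewrite big_ord0 mulr1.
by rewrite /= !IH big_ord_recr /= exprS; ring.
Qed.

Lemma qdiff_poly n (Q : {poly R}) : (size Q <= n)%N ->
  qdiff n (fun j => Q.[p ^+ j]) 0 = 0.
Proof.
move=> sQ; rewrite qdiffE.
under eq_bigr do rewrite horner_coef mulr_sumr.
rewrite exchange_big /= big1 // => r _.
have := qdiff_exp n r 0; rewrite qdiffE mul1r (bigD1 (Ordinal (leq_trans (ltn_ord r) sQ))) //=.
rewrite mulfV ?expf_neq0// subrr mul0r => e.
rewrite -[RHS](mulr0 Q`_r) -[X in _ = _ * X]e mulr_sumr; apply: eq_bigr => j _.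
by rewrite -!exprM mulnC mulrCA.
Qed.

(** A q-analogue of the [n]-th derivative of [1 / (1 - b X)]: every operator adds one linear factor
    to the denominator. It yields the squared norms. *)
Lemma qdiff_pole n b m : (forall j, 1 - b * p ^+ j != 0) ->
  qdiff n (fun j => (1 - b * p ^+ j)^-1) m =
  qpoch p p n * (b * p ^+ m) ^+ n / qpoch (b * p ^+ m) p n.+1.
Proof.
move=> b0; elim: n m => [|n IH] m.
  by rewrite /= qpochS !qpoch0 !expr0 !mulr1 !mul1r.
have nz m' n' : qpoch (b * p ^+ m') p n' != 0.
  by apply/prodf_neq0 => i _; rewrite -mulrA -exprD.
rewrite /= !IH [qpoch (_ * p ^+ m.+1) _ _]qpochS.
rewrite [qpoch (_ * p ^+ m) _ n.+2]qpochS [qpoch (_ * p ^+ m) _ n.+1]qpochSl.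
rewrite (_ : b * p ^+ m * p = b * p ^+ m.+1); last by rewrite exprS; ring.
rewrite qpochS !exprMn !exprS.
have h1 := nz m.+1 n; have h2 := b0 m; have h3 := b0 (m + n).+1.
rewrite exprS in h1.
have pn0 : p ^+ n != 0 by rewrite expf_neq0.
rewrite exprS exprD in h3.
set X := p ^+ m in h1 h2 h3 *; set Y := p ^+ n in h3 pn0 *.
rewrite (_ : (p * X) ^+ n = Y * X ^+ n); last by rewrite exprMn.
field; rewrite h1 h2 pn0 /=.
by rewrite (_ : _ - _ = 1 - b * (p * (X * Y))) ?h3 //; ring.
Qed.

End Base.
End QPochhammer.

(** * Real series *)

Section HasSum.
Local Open Scope classical_set_scope.
Local Open Scope ring_scope.
Context {R : realType}.
Implicit Types (u v : nat -> R) (l c : R).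

(** A relation rather than a value, so that each statement about a sum also asserts convergence. *)
Definition has_sum u l := series u @ \oo --> l.

Lemma has_sum_unique u l l' : has_sum u l -> has_sum u l' -> l = l'.
Proof. by move=> h h'; apply: (cvg_unique _ h h'); exact: norm_hausdorff. Qed.

Lemma eq_has_sum u v l : u =1 v -> has_sum u l -> has_sum v l.
Proof. by move=> /funext ->. Qed.

Lemma has_sum0 : has_sum (fun=> 0) 0.
Proof.
rewrite /has_sum (_ : series _ = fun=> 0); first exact: cvg_cst.
by apply/funext => n; rewrite seriesEnat /= big1.
Qed.

Lemma has_sumD u v l l' : has_sum u l -> has_sum v l' ->
  has_sum (fun n => u n + v n) (l + l').
Proof.
move=> h h'; rewrite /has_sum (_ : series _ = series u \+ series v)%R.
  exact: cvgD.
by apply/funext => n; rewrite /= !seriesEnat /= big_split.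
Qed.

Lemma has_sumZ c u l : has_sum u l -> has_sum (fun n => c * u n) (c * l).
Proof.
move=> h; rewrite /has_sum (_ : series _ = fun n => c * series u n).
  exact: cvgMl_tmp.
by apply/funext => n; rewrite !seriesEnat /= mulr_sumr.
Qed.

Lemma has_sumB u v l l' : has_sum u l -> has_sum v l' ->
  has_sum (fun n => u n - v n) (l - l').
Proof.
move=> h /(has_sumZ (c := -1)) h'; rewrite -mulN1r.
by apply: eq_has_sum (has_sumD h h') => n; rewrite mulN1r.
Qed.

Lemma has_sum_sum N (F : nat -> nat -> R) (l : nat -> R) :
  (forall i, (i < N)%N -> has_sum (F i) (l i)) ->
  has_sum (fun n => \sum_(i < N) F i n) (\sum_(i < N) l i).
Proof.
elim: N => [|N IH] h.
  by rewrite big_ord0; apply: eq_has_sum has_sum0 => n; rewrite big_ord0.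
rewrite big_ord_recr /=.
have hN := IH (fun i iN => h i (ltnW iN)).
by apply: eq_has_sum (has_sumD hN (h N _)) => // n; rewrite big_ord_recr.
Qed.

Lemma has_sum_shift N u l : has_sum (fun n => u (n + N)%N) l ->
  has_sum u (\sum_(i < N) u i + l).
Proof.
move=> h; rewrite /has_sum -(cvg_shiftn N).
rewrite (_ : [sequence _]_n%R =
   fun n => \sum_(i < N) u i + series (fun n => u (n + N)%N) n); last first.
  apply/funext => n /=.
  rewrite !seriesEnat /= (@big_cat_nat _ _ _ N) ?leq_addl //= big_mkord; congr (_ + _).
  by rewrite -{1}[N]add0n big_addn addnK.
by apply: cvgD => //; exact: cvg_cst.
Qed.

Lemma has_sum_finite N u : (forall n, (N <= n)%N -> u n = 0) -> has_sum u (\sum_(i < N) u i).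
Proof.
move=> u0; rewrite -[X in has_sum _ X]addr0; apply: has_sum_shift.
by apply: eq_has_sum has_sum0 => n; rewrite u0 // leq_addl.
Qed.

Lemma has_sum_tail N u l : has_sum u l ->
  has_sum (fun n => u (n + N)%N) (l - \sum_(i < N) u i).
Proof.
move=> h; rewrite /has_sum.
rewrite (_ : series _ =
   fun n => [sequence series u (n + N)%N]_n n - \sum_(i < N) u i); last first.
  apply/funext => n /=.
  rewrite !seriesEnat /= [in RHS](@big_cat_nat _ _ _ N) ?leq_addl //=.
  rewrite [\sum_(0 <= k < N) _]big_mkord [_ + \sum_(N <= k < _) _]addrC addrK.
  by rewrite -{2}[N]add0n big_addn addnK.
by apply: cvgB; [rewrite cvg_shiftn|exact: cvg_cst].
Qed.

Lemma has_sum_le u v l l' : (forall n, u n <= v n) ->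
  has_sum u l -> has_sum v l' -> l <= l'.
Proof.
move=> uv h h'; apply: ler_cvg_to h h' _.
by near=> n; rewrite !seriesEnat /= ler_sum.
Unshelve. all: by end_near.
Qed.

Lemma has_sum_norm_le u v l l' : (forall n, `|u n| <= v n) ->
  has_sum u l -> has_sum v l' -> `|l| <= l'.
Proof.
move=> uv h h'; rewrite ler_norml; apply/andP; split.
  rewrite -mulN1r; apply: has_sum_le (has_sumZ (c := -1) h') h => n.
  by rewrite mulN1r; have := uv n; rewrite ler_norml => /andP[].
by apply: has_sum_le h h' => n; have := uv n; rewrite ler_norml => /andP[].
Qed.

Lemma has_sum_ge0 u l : (forall n, 0 <= u n) -> has_sum u l -> 0 <= l.
Proof. by move=> u0 h; apply: has_sum_le has_sum0 h. Qed.

Lemma has_sum_partial_le u l n : (forall n, 0 <= u n) -> has_sum u l ->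
  \sum_(i < n) u i <= l.
Proof.
move=> u0 /(has_sum_tail (N := n)) h; rewrite -subr_ge0.
by apply: has_sum_ge0 h => m.
Qed.

Lemma has_sum_geometric c z : `|z| < 1 -> has_sum (fun n => c * z ^+ n) (c / (1 - z)).
Proof. exact: cvg_geometric_series. Qed.

Lemma has_sum_dominated u v l' : (forall n, `|u n| <= v n) -> has_sum v l' ->
  exists l, has_sum u l.
Proof.
move=> uv h; exists (limn (series u)).
apply: (@normed_cvg R R).
apply: (series_le_cvg (v_ := v)) => //=.
- by move=> n; exact: le_trans (uv n).
- by apply: cvgP h.
Qed.

Lemma has_sum_geometric_dominated u c z : 0 <= z -> z < 1 ->
  (forall n, `|u n| <= c * z ^+ n) -> exists l, has_sum u l.
Proof.
move=> z0 z1 uc; apply: has_sum_dominated uc (has_sum_geometric _).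
by rewrite ger0_norm.
Qed.

Lemma norm_sum_tail_le u v l l' N : (forall n, `|u n| <= v n) ->
  has_sum u l -> has_sum v l' ->
  `|\sum_(i < N) u i - l| <= l' - \sum_(i < N) v i.
Proof.
move=> uv h h'; rewrite distrC.
by apply: has_sum_norm_le (has_sum_tail (N := N) h) (has_sum_tail (N := N) h').
Qed.

Lemma has_sum_dist u l : (forall e : R, 0 < e ->
    exists N0, forall N, (N0 <= N)%N -> `|\sum_(i < N) u i - l| <= e) ->
  has_sum u l.
Proof.
move=> h; apply/cvgrPdist_le => e e0; have [N0 hN] := h _ e0.
exists N0 => // N /= NN0; rewrite distrC seriesEnat /= big_mkord.
exact: hN.
Qed.

Lemma has_sum_distP u l e : has_sum u l -> 0 < e ->
    exists N0, forall N, (N0 <= N)%N -> `|\sum_(i < N) u i - l| <= e.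
Proof.
move=> h e0; have /cvgrPdist_le/(_ _ e0)[N0 _ hN] := h.
exists N0 => N NN0; have := hN N NN0.
by rewrite distrC seriesEnat /= big_mkord.
Qed.

(** Dominated convergence for series. The first [N] terms of every row miss its sum by at most the
    tail of [v], uniformly in the row; passing to the limit over the rows keeps this bound. *)
Lemma tannery (h : nat -> nat -> R) (u v L : nat -> R) l l' :
  (forall N n, `|h N n| <= v n) -> has_sum v l' ->
  (forall n, h^~ n @ \oo --> u n) ->
  (forall N, has_sum (h N) (L N)) -> L @ \oo --> l -> has_sum u l.
Proof.
move=> hv vl' hu hL Ll; apply: has_sum_dist => e e0.
have [N0 hN0] := has_sum_distP vl' e0; exists N0 => N NN0.
have lim1 : (fun M => \sum_(i < N) h M i - L M) @ \oo --> \sum_(i < N) u i - l.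
  apply: cvgB Ll; rewrite /=.
  elim: N {NN0} => [|N IH].
    rewrite big_ord0 (_ : (fun M => _) = fun=> 0); first exact: cvg_cst.
    by apply/funext => M; rewrite big_ord0.
  rewrite big_ord_recr /=.
  rewrite (_ : (fun M => _) = fun M => \sum_(i < N) h M i + h M N).
    by apply: cvgD.
  by apply/funext => M; rewrite big_ord_recr.
apply: le_trans (hN0 N NN0); rewrite [leRHS]distrC.
apply: le_trans (ler_norm _).
have lim3 : (fun=> l' - \sum_(i < N) v i) @ \oo --> l' - \sum_(i < N) v i by exact: cvg_cst.
apply: (ler_cvg_to (cvg_norm lim1) lim3).
near=> M; exact: norm_sum_tail_le.
Unshelve. all: by end_near.
Qed.

Lemma has_sum_partial_bound u l c : (forall N, \sum_(i < N) `|u i| <= c) ->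
  has_sum u l -> `|l| <= c.
Proof.
move=> uc h; apply/ler_addgt0Pr => e e0.
have [N hN] := has_sum_distP h e0.
have := hN N (leqnn N); rewrite distrC => hl.
rewrite -[l](subrK (\sum_(i < N) u i)) addrC; apply: le_trans (ler_normD _ _) _.
by apply: lerD hl; apply: le_trans (ler_norm_sum _ _ _) (uc N).
Qed.

Lemma has_sum_delta n u : has_sum (fun m => (m == n)%:R * u m) (u n).
Proof.
have := @has_sum_finite n.+1 (fun m => (m == n)%:R * u m) _.
rewrite big_ord_recr /= eqxx mul1r big1 ?add0r => [|i _].
  by apply=> m nm; rewrite gtn_eqF // mul0r.
by rewrite ltn_eqF // mul0r.
Qed.

End HasSum.

(** * The q-binomial theorem *)

Section QBinomial.
Local Open Scope classical_set_scope.
Local Open Scope ring_scope.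
Context {R : realType}.
Variable p : R.
Hypotheses (p_gt0 : 0 < p) (p_lt1 : p < 1).
Implicit Types (a b z : R).

Let p_normlt1 : `|p| < 1. Proof. by rewrite gtr0_norm. Qed.

Lemma qpoch_nonincreasing a : 0 <= a -> a < 1 ->
  {homo qpoch a p : m n / (m <= n)%N >-> n <= m}.
Proof.
move=> a0 a1; apply/nonincreasing_seqP => n; rewrite qpochS ler_piMr //.
  by rewrite ltW // qpoch_gt0.
by rewrite gerBl mulr_ge0 // exprn_ge0 // ltW.
Qed.

Lemma cvg_qpoch a : 0 <= a -> a < 1 -> qpoch a p @ \oo --> qpoch_inf a p.
Proof.
move=> a0 a1; apply: nonincreasing_is_cvgn; first exact: qpoch_nonincreasing.
by exists 0 => _ [n _ <-]; rewrite ltW // qpoch_gt0.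
Qed.

Lemma qpoch_inf_le a n : 0 <= a -> a < 1 -> qpoch_inf a p <= qpoch a p n.
Proof.
move=> a0 a1; apply: nonincreasing_cvgn_ge; first exact: qpoch_nonincreasing.
by apply/cvg_ex; exists (qpoch_inf a p); exact: cvg_qpoch.
Qed.

Lemma qpoch_inf_le1 a : 0 <= a -> a < 1 -> qpoch_inf a p <= 1.
Proof. by move=> a0 a1; rewrite -(qpoch0 a p); exact: qpoch_inf_le. Qed.

Lemma qpoch_infD a n : 0 <= a -> a < 1 ->
  qpoch_inf a p = qpoch a p n * qpoch_inf (a * p ^+ n) p.
Proof.
move=> a0 a1.
have h1 : (fun m => qpoch a p (n + m)) @ \oo --> qpoch_inf a p.
  rewrite (_ : (fun m => _) = [sequence qpoch a p (m + n)]_m).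
    by rewrite cvg_shiftn; exact: cvg_qpoch.
  by apply/funext => m /=; rewrite addnC.
have h2 : (fun m => qpoch a p (n + m)) @ \oo --> qpoch a p n * qpoch_inf (a * p ^+ n) p.
  rewrite (_ : (fun m => _) = fun m => qpoch a p n * qpoch (a * p ^+ n) p m).
    apply: cvgMl_tmp; apply: cvg_qpoch.
      by rewrite mulr_ge0 // exprn_ge0 // ltW.
    by apply: le_lt_trans a1; rewrite ler_piMr // exp_le1.
  by apply/funext => m; rewrite qpochD.
by apply: (cvg_unique _ h1 h2); exact: norm_hausdorff.
Qed.

(** A product of factors [1 - a_i] is at least one minus the sum of the [a_i], here a geometric
    sum. *)
Lemma weierstrass_ineq a n : 0 <= a -> a < 1 ->
  1 - a * (1 - p ^+ n) / (1 - p) <= qpoch a p n.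
Proof.
move=> a0 a1; elim: n => [|n IH].
  by rewrite expr0 subrr mulr0 mul0r subr0 qpoch0.
rewrite qpochS.
have f0 : 0 <= 1 - a * p ^+ n by rewrite ltW // factor_gt0.
apply: le_trans (ler_wpM2r f0 IH); rewrite exprS.
have y0 : 0 <= p ^+ n by rewrite exprn_ge0 // ltW.
have y1 : p ^+ n <= 1 by exact: exp_le1.
have q0 : 0 < 1 - p by rewrite subr_gt0.
set y := p ^+ n in y0 y1 *.
rewrite -subr_ge0 (_ : _ - _ = a ^+ 2 * (1 - y) * y / (1 - p)).
  by rewrite divr_ge0 ?mulr_ge0 ?sqr_ge0 ?subr_ge0 // ltW.
by field; rewrite gt_eqF.
Qed.

Lemma qpoch_inf_gt0 a : 0 <= a -> a < 1 -> 0 < qpoch_inf a p.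
Proof.
move=> a0 a1.
have q0 : 0 < 1 - p by rewrite subr_gt0.
(* The product inequality is void when [a / (1 - p)] is at least 1. Splitting off [N] positive
   factors replaces [a] by [a p^N] and makes the lower bound [1/2] available. *)
have [N hN] : exists N, a * p ^+ N / (1 - p) <= 2^-1.
  have /cvgrPdist_le/(_ ((1 - p) / 2)) [|N _ hN] := cvg_expr p_normlt1.
    by rewrite divr_gt0.
  have pN0 : 0 <= p ^+ N by rewrite exprn_ge0 // ltW.
  exists N; have := hN N (leqnn N); rewrite /= sub0r normrN ger0_norm // => h.
  by rewrite ler_pdivrMr //; nra.
rewrite (qpoch_infD N) //; apply: mulr_gt0; first exact: qpoch_gt0.
have pN0 : 0 <= p ^+ N by rewrite exprn_ge0 // ltW.
have b0 : 0 <= a * p ^+ N by rewrite mulr_ge0.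
have b1 : a * p ^+ N < 1 by apply: le_lt_trans a1; rewrite ler_piMr // exp_le1.
apply: (@lt_le_trans _ _ 2^-1); first by [].
have -> : qpoch_inf (a * p ^+ N) p = lim (qpoch (a * p ^+ N) p @ \oo) by [].
apply: limr_ge; first by apply/cvg_ex; exists (qpoch_inf (a * p ^+ N) p); exact: cvg_qpoch.
near=> n; apply: le_trans (weierstrass_ineq n b0 b1).
have : a * p ^+ N * (1 - p ^+ n) / (1 - p) <= 2^-1.
  apply: le_trans hN; rewrite ler_pM2r ?invr_gt0 // ler_piMr // gerBl.
  by rewrite exprn_ge0 // ltW.
by lra.
Unshelve. all: by end_near.
Qed.

Lemma qpoch_ratio_le b n : 0 <= b -> b < 1 ->
  0 <= qpoch b p n / qpoch p p n <= (qpoch_inf p p)^-1.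
Proof.
move=> b0 b1.
have p0 := qpoch_gt0 p_gt0 p_lt1 n p_lt1.
have b'0 := qpoch_gt0 p_gt0 p_lt1 n b1.
have h0 := qpoch_inf_gt0 (ltW p_gt0) p_lt1.
apply/andP; split; first by rewrite divr_ge0 // ltW.
rewrite ler_pdivrMr // mulrC ler_pdivlMr //.
have := qpoch_le1 p_gt0 p_lt1 n b0 b1.
have := qpoch_inf_le n (ltW p_gt0) p_lt1.
nra.
Qed.

Let K : R := (qpoch_inf p p)^-1.

Lemma qbinomial_term_le b z n : 0 <= b -> b < 1 -> 0 <= z ->
  `|z ^+ n * (qpoch b p n / qpoch p p n)| <= K * z ^+ n.
Proof.
move=> b0 b1 z0; have /andP[h1 h2] := qpoch_ratio_le n b0 b1.
rewrite normrM !ger0_norm // ?exprn_ge0 // mulrC.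
by rewrite ler_wpM2r // exprn_ge0.
Qed.

Lemma qbinomial_sum_exists b z : 0 <= b -> b < 1 -> 0 <= z -> z < 1 ->
  exists l, has_sum (fun n => z ^+ n * (qpoch b p n / qpoch p p n)) l.
Proof.
move=> b0 b1 z0 z1; apply: (has_sum_geometric_dominated z0 z1) => n.
exact: qbinomial_term_le.
Qed.

(* The sum [F z] satisfies [(1 - z) F z = (1 - b z) F (p z)]. *)
Lemma qbinomial_step b z l l' : 0 <= b -> b < 1 ->
  has_sum (fun n => z ^+ n * (qpoch b p n / qpoch p p n)) l ->
  has_sum (fun n => (p * z) ^+ n * (qpoch b p n / qpoch p p n)) l' ->
  (1 - z) * l = (1 - b * z) * l'.
Proof.
move=> b0 b1 hl hl'.
have /(has_sum_tail (N := 1)) h := has_sumB hl hl'.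
have h' := has_sumB (has_sumZ (c := z) hl) (has_sumZ (c := b * z) hl').
rewrite big_ord1 !qpoch0 !expr0 subrr subr0 in h.
suff e : l - l' = z * l - b * z * l'.
  apply: subr0_eq; rewrite (_ : _ - _ = (l - l') - (z * l - b * z * l')); last by ring.
  by rewrite e subrr.
apply: has_sum_unique h _; apply: eq_has_sum h' => n.
rewrite addn1 !qpochS !exprS !exprMn.
have h1 : 1 - p * p ^+ n != 0 by rewrite gt_eqF // factor_gt0.
have h2 := qpoch_neq0 p_gt0 p_lt1 n p_lt1.
by field; rewrite h1 h2.
Qed.

Lemma qbinomial_norm_sub1_le b z l : 0 <= b -> b < 1 -> 0 <= z -> z < 1 ->
  has_sum (fun n => z ^+ n * (qpoch b p n / qpoch p p n)) l ->
  `|l - 1| <= K * z / (1 - z).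
Proof.
move=> b0 b1 z0 z1 /(has_sum_tail (N := 1)).
rewrite big_ord1 !qpoch0 expr0 divr1 mul1r => h.
have hz : `|z| < 1 by rewrite ger0_norm.
apply: has_sum_norm_le h (has_sum_geometric (c := K * z) hz) => n.
apply: le_trans (qbinomial_term_le _ b0 b1 z0) _.
by rewrite addn1 exprS mulrA.
Qed.

(** Iterating the functional equation gives [(z;p)_n F(z) = (b z;p)_n F(p^n z)], and [F(p^n z)]
    tends to the constant term 1. *)
Theorem qbinomial b z : 0 <= b -> b < 1 -> 0 <= z -> z < 1 ->
  has_sum (fun n => z ^+ n * (qpoch b p n / qpoch p p n))
          (qpoch_inf (b * z) p / qpoch_inf z p).
Proof.
move=> b0 b1 z0 z1.
have zn0 n : 0 <= p ^+ n * z by rewrite mulr_ge0 // exprn_ge0 // ltW.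
have zn1 n : p ^+ n * z < 1 by apply: le_lt_trans z1; rewrite ler_piMl // exp_le1.
have /choice [F hF] : forall n, exists l, has_sum
    (fun m => (p ^+ n * z) ^+ m * (qpoch b p m / qpoch p p m)) l.
  by move=> n; exact: qbinomial_sum_exists.
have bz0 : 0 <= b * z by rewrite mulr_ge0.
have bz1 : b * z < 1 by apply: le_lt_trans z1; rewrite ler_piMl // ltW.
have FE n : qpoch z p n * F 0%N = qpoch (b * z) p n * F n.
  elim: n => [|n IH]; first by rewrite !qpoch0.
  rewrite !qpochS mulrAC IH mulrAC -[LHS]mulrA -[RHS]mulrA; congr (_ * _).
  have h := hF n.+1; rewrite exprS -mulrA in h.
  by have := qbinomial_step b0 b1 (hF n) h; rewrite mulrA [z * _]mulrC [b * z * _]mulrAC -[b * _ * z]mulrA mulrC.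
have F1 : F @ \oo --> (1 : R).
  have z'0 : 0 < 1 - z by rewrite subr_gt0.
  apply/cvgrPdist_le => e e0.
  have K0 : 0 <= K by rewrite invr_ge0 ltW // qpoch_inf_gt0 // ltW.
  have lim0 : (fun n => K * z / (1 - z) * p ^+ n) @ \oo --> (0 : R).
    by rewrite -[X in _ --> X](mulr0 (K * z / (1 - z))); apply: cvgMl_tmp; exact: cvg_expr.
  have /cvgrPdist_le/(_ e e0)[N _ hN] := lim0.
  exists N => // n /= Nn; rewrite distrC.
  apply: le_trans (qbinomial_norm_sub1_le b0 b1 (zn0 n) (zn1 n) (hF n)) _.
  have := hN n Nn; rewrite sub0r normrN; apply: le_trans; apply: le_trans (ler_norm _).
  have h1 : 0 < 1 - p ^+ n * z by rewrite subr_gt0.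
  rewrite -!mulrA [X in K * X](_ : _ = z * p ^+ n * (1 - p ^+ n * z)^-1); last by ring.
  rewrite [X in _ <= K * X](_ : _ = z * p ^+ n * (1 - z)^-1); last by ring.
  have pn0 : 0 <= p ^+ n by rewrite exprn_ge0 // ltW.
  rewrite ler_wpM2l // ler_wpM2l ?mulr_ge0 // lef_pV2 ?posrE //.
  by rewrite lerD2l lerN2 ler_piMl // exp_le1.
have e1 : (fun n => qpoch z p n * F 0%N) @ \oo --> qpoch_inf z p * F 0%N.
  by apply: cvgMr_tmp; exact: cvg_qpoch.
have e2 : (fun n => qpoch z p n * F 0%N) @ \oo --> qpoch_inf (b * z) p * 1.
  by rewrite (funext FE); apply: cvgM F1; exact: cvg_qpoch.
have := cvg_unique (@norm_hausdorff _ _) e1 e2; rewrite mulr1 => e.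
have := hF 0%N; rewrite expr0 mul1r; congr has_sum.
by rewrite -e mulrAC mulfV ?mul1r // gt_eqF // qpoch_inf_gt0.
Qed.

End QBinomial.

(** * Little q-Jacobi polynomials *)

Section LinearProducts.
Context {R : realType}.
Implicit Types (d : nat -> R) (n : nat).

(** Common form of the Newton basis and of the test basis; as polynomials they have a degree bound
    and an explicit top coefficient. *)
Definition linprod n d : {poly R} := \prod_(i < n) (1 - d i *: 'X).

Lemma horner_linprod n d y : (linprod n d).[y] = \prod_(i < n) (1 - d i * y).
Proof.
by rewrite horner_prod; apply: eq_bigr => i _; rewrite !hornerE.
Qed.

Lemma linprodS n d : linprod n.+1 d = linprod n d - d n *: (linprod n d * 'X).
Proof. by rewrite /linprod big_ord_recr /= mulrBr mulr1 scalerAr. Qed.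

Lemma size_linprod n d : (size (linprod n d) <= n.+1)%N.
Proof.
elim: n => [|n IH]; first by rewrite /linprod big_ord0 size_polyC oner_eq0.
rewrite linprodS (leq_trans (size_polyD _ _)) // size_polyN geq_max (leq_trans IH) //=.
rewrite (leq_trans (size_scale_leq _ _)) // (leq_trans (size_polyMleq _ _)) //.
by rewrite size_polyX addn2.
Qed.

Lemma coef_linprod n d : (linprod n d)`_n = \prod_(i < n) (- d i).
Proof.
elim: n => [|n IH]; first by rewrite /linprod !big_ord0 coefC.
rewrite linprodS coefB coefZ coefMX /= IH big_ord_recr /=.
by rewrite nth_default ?size_linprod // sub0r mulrN mulrC.
Qed.

End LinearProducts.

Section LittleQJacobi.
Context {R : realType}.
Variables p a c : R.
Hypotheses (p_gt0 : 0 < p) (p_lt1 : p < 1).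
Hypotheses (a_gt0 : 0 < a) (ap_lt1 : a * p < 1) (c_gt0 : 0 < c) (c_lt1 : c < 1).
Implicit Types (x n j l : nat).

Let p_neq0 : p != 0. Proof. by rewrite gt_eqF. Qed.
Let a_neq0 : a != 0. Proof. by rewrite gt_eqF. Qed.
Let c_neq0 : c != 0. Proof. by rewrite gt_eqF. Qed.
Let pX_gt0 n : 0 < p ^+ n. Proof. exact: exprn_gt0. Qed.
Let pX_neq0 n : p ^+ n != 0. Proof. by rewrite expf_neq0. Qed.
Let ap_ge0 : 0 <= a * p. Proof. by rewrite mulr_ge0 // ltW. Qed.

Lemma cpX_ge0 n : 0 <= c * p ^+ n.
Proof. by rewrite mulr_ge0 // ltW. Qed.

Lemma cpX_lt1 n : c * p ^+ n < 1.
Proof. by apply: le_lt_trans c_lt1; rewrite ler_piMr ?exp_le1 // ltW. Qed.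

Lemma acpX_ge0 n : 0 <= a * c * p ^+ n.
Proof. by rewrite !mulr_ge0 // ltW. Qed.

Lemma acpX_lt1 n : (0 < n)%N -> a * c * p ^+ n < 1.
Proof.
case: n => // n _; rewrite (_ : _ * _ = (a * p) * (c * p ^+ n)); last by rewrite exprS; ring.
apply: le_lt_trans ap_lt1; rewrite ler_piMr //.
by rewrite ltW // cpX_lt1.
Qed.

(* The Newton basis for the nodes [X = p^i]: [newton j] vanishes at [p^n] for
   [n < j]. With [p = q^2], [a = q^(2s)] and [c = q^(2k)], the sum in the
   definition of [phi] is the value at [X = p^n] of the polynomial [jacobi x]
   below; [weight] and [dual_weight] correspond to [w_k q^(n(2s+k+1))] and [W_k]. *)
Definition newton j : {poly R} := linprod j (fun i => p ^- i).

Definition jacobi_coef x j : R :=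
  qpoch (p ^- x) p j * qpoch (a * c * p ^+ x) p j / (a ^+ j * qpoch c p j * qpoch p p j).

Definition jacobi x : {poly R} := \sum_(j < x.+1) jacobi_coef x j *: newton j.

Definition weight n : R := (a * p) ^+ n * (qpoch c p n / qpoch p p n).

Definition dual_weight x : R :=
  (if x == 0%N then 1 else (1 - a * c * p ^+ (x + x)) / (1 - a * c * p ^+ x)) *
  (qpoch c p x / qpoch p p x) *
  (qpoch_inf (a * p ^+ x.+1) p / qpoch_inf (a * c * p ^+ x.+1) p) *
  (p ^+ (x * x) * a ^+ x).

Lemma horner_newton j n : (newton j).[p ^+ n] = qpoch (p ^+ n) p^-1 j.
Proof.
by rewrite horner_linprod; apply: eq_bigr => i _; rewrite exprVn mulrC.
Qed.

Lemma horner_jacobi x n :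
  (jacobi x).[p ^+ n] = \sum_(j < x.+1) jacobi_coef x j * qpoch (p ^+ n) p^-1 j.
Proof.
by rewrite /jacobi horner_sum; apply: eq_bigr => j _; rewrite hornerZ horner_newton.
Qed.

Lemma size_jacobi x : (size (jacobi x) <= x.+1)%N.
Proof.
apply: (leq_trans (size_sum _ _ _)); apply/bigmax_leqP => j _.
rewrite (leq_trans (size_scale_leq _ _)) // (leq_trans (size_linprod _ _)) //.
Qed.

Lemma coef_jacobi x : (jacobi x)`_x = jacobi_coef x x * \prod_(i < x) (- p ^- i).
Proof.
rewrite /jacobi big_ord_recr /= coefD coefZ coef_linprod coef_sum big1 ?add0r // => j _.
by rewrite coefZ nth_default ?mulr0 // (leq_trans (size_linprod _ _)).
Qed.

Lemma qpoch_falling r j : qpoch (p ^+ (r + j)) p^-1 j * qpoch p p r = qpoch p p (r + j).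
Proof.
elim: j => [|j IH]; first by rewrite addn0 qpoch0 mul1r.
rewrite addnS [in LHS]qpochSl exprSr mulfK // -mulrA IH qpochS mulrC.
by rewrite -exprS -exprSr.
Qed.

Lemma qpoch_falling0 n j : (n < j)%N -> qpoch (p ^+ n) p^-1 j = 0.
Proof.
move=> nj; rewrite /qpoch (bigD1 (Ordinal nj)) //= exprVn mulfV //.
by rewrite subrr mul0r.
Qed.

(* Against the basis [(c X; p)_l] of test polynomials the moments of the Newton
   basis are summed by the q-binomial theorem; what remains is a q-difference of
   order [x], of a polynomial when [l < x] and of a polynomial divided by a linear
   factor when [l = x]. *)
Lemma newton_test_sum j l :
  has_sum (fun n => weight n * qpoch (c * p ^+ n) p l * qpoch (p ^+ n) p^-1 j)
    (qpoch c p j * qpoch (c * p ^+ j) p l * (a * p) ^+ j *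
     (qpoch_inf (a * c * p ^+ (j + l).+1) p / qpoch_inf (a * p) p)).
Proof.
set C := _ * (a * p) ^+ j.
have := has_sumZ (c := C) (qbinomial p_gt0 p_lt1 (cpX_ge0 (j + l)) (cpX_lt1 (j + l)) ap_ge0 ap_lt1).
rewrite (_ : c * p ^+ (j + l) * (a * p) = a * c * p ^+ (j + l).+1); last by rewrite exprS; ring.
move=> h; rewrite -[X in has_sum _ X]add0r.
(* The nodes with [i < j] contribute nothing. At [n = r + j] the symbols recombine into the
   q-binomial series in [r] with parameter [c p^(j+l)] and argument [a p]. *)
rewrite -[X in X + _](_ : \sum_(i < j)
    weight i * qpoch (c * p ^+ i) p l * qpoch (p ^+ i) p^-1 j = _); last first.
  by rewrite big1 // => i _; rewrite (qpoch_falling0 (ltn_ord i)) mulr0.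
apply: has_sum_shift; apply: eq_has_sum h => r.
rewrite /weight -(qpoch_falling r j) [(a * p) ^+ (r + j)]exprD.
have e : qpoch c p (r + j) * qpoch (c * p ^+ (r + j)) p l =
    qpoch c p j * qpoch (c * p ^+ j) p l * qpoch (c * p ^+ (j + l)) p r.
  by rewrite -!qpochD; congr qpoch; lia.
have h1 := qpoch_neq0 p_gt0 p_lt1 r p_lt1.
have h2 : qpoch (p ^+ (r + j)) p^-1 j != 0.
  have := qpoch_neq0 p_gt0 p_lt1 (r + j) p_lt1; rewrite -qpoch_falling.
  by apply: contraNneq => ->; rewrite mul0r.
apply: esym; rewrite /C; set X := qpoch (p ^+ (r + j)) _ _ in h2 *.
transitivity ((a * p) ^+ r * (a * p) ^+ j / qpoch p p r *
   (qpoch c p (r + j) * qpoch (c * p ^+ (r + j)) p l)).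
  by field; rewrite h1 h2.
by rewrite e; field.
Qed.

Let test l := linprod l (fun i => c * p ^+ i).

Lemma horner_test l n : (test l).[p ^+ n] = qpoch (c * p ^+ n) p l.
Proof.
by rewrite horner_linprod; apply: eq_bigr => i _; rewrite -!mulrA [_ * p ^+ n]mulrC.
Qed.

Lemma test_jacobi_sum l x :
  has_sum (fun n => weight n * (test l).[p ^+ n] * (jacobi x).[p ^+ n])
    (\sum_(j < x.+1) qpoch (p ^- x) p j / qpoch p p j * p ^+ j *
       (qpoch (a * c * p ^+ x) p j * qpoch (c * p ^+ j) p l *
        (qpoch_inf (a * c * p ^+ (j + l).+1) p / qpoch_inf (a * p) p))).
Proof.
have := @has_sum_sum _ x.+1 (fun j n => jacobi_coef x j *
  (weight n * qpoch (c * p ^+ n) p l * qpoch (p ^+ n) p^-1 j)) _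
  (fun j _ => has_sumZ (c := jacobi_coef x j) (@newton_test_sum j l)).
congr has_sum.
  apply/funext => n; rewrite horner_jacobi horner_test mulr_sumr.
  by apply: eq_bigr => j _; rewrite mulrCA.
apply: eq_bigr => j _; rewrite /jacobi_coef exprMn.
have h1 := qpoch_neq0 p_gt0 p_lt1 j p_lt1.
have h2 := qpoch_neq0 p_gt0 p_lt1 j c_lt1.
have h3 : qpoch_inf (a * p) p != 0 by rewrite gt_eqF // qpoch_inf_gt0.
have h4 : a ^+ j != 0 by rewrite expf_neq0.
by field; rewrite h1 h2 h3 h4.
Qed.

Lemma test_jacobi_orth l x : (l < x)%N ->
  has_sum (fun n => weight n * (test l).[p ^+ n] * (jacobi x).[p ^+ n]) 0.
Proof.
move=> lx; have := @test_jacobi_sum l x; congr has_sum.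
have [d xE] : exists d, x = (l.+1 + d)%N by exists (x - l.+1)%N; rewrite subnKC.
(* By telescoping, [(a c p^x;p)_j (a c p^(j+l+1);p)_oo] equals [(a c p^x;p)_oo (a c p^(l+1+j);p)_d].
   The summand is therefore a polynomial in [p^j] of degree at most [l + d = x - 1], which a
   difference of order [x] kills. *)
pose G := linprod l (fun i => c * p ^+ i) * linprod d (fun i => a * c * p ^+ (l.+1 + i)).
have sG : (size G <= x)%N.
  rewrite (leq_trans (size_polyMleq _ _)) //.
  have := leq_add (size_linprod l (fun i => c * p ^+ i))
    (size_linprod d (fun i => a * c * p ^+ (l.+1 + i))).
  by rewrite xE addSn addnS => h; rewrite -subn1 leq_subLR.
have := qdiff_poly p_gt0 p_lt1 sG; rewrite qdiffE //.
move=> /(congr1 (fun u => qpoch_inf (a * c * p ^+ x) p / qpoch_inf (a * p) p * u)).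
rewrite mulr0 mulr_sumr => e; apply: etrans e; apply: eq_bigr => j _.
rewrite add0n hornerM [(linprod l _).[_]]horner_test.
have -> : (linprod d (fun i => a * c * p ^+ (l.+1 + i))).[p ^+ j] =
   qpoch (a * c * p ^+ (j + l).+1) p d.
  rewrite horner_linprod; apply: eq_bigr => i _.
  by rewrite -!mulrA -!exprD !addSn addnC addnA.
have x0 : (0 < x)%N by case: (x) lx.
rewrite (qpoch_infD p_gt0 p_lt1 d (acpX_ge0 _)) ?acpX_lt1 //.
rewrite [in RHS](qpoch_infD p_gt0 p_lt1 j (acpX_ge0 _)) ?acpX_lt1 //.
rewrite -![a * c * _ * _]mulrA -!exprD.
rewrite (_ : ((j + l).+1 + d = x + j)%N); last by lia.
by ring.
Qed.

(** This is [p^(x(x+1)/2)], kept as a product to avoid the division by 2. *)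
Let T x : R := \prod_(i < x) p ^+ i.+1.

Lemma triangle_neq0 x : T x != 0.
Proof. by apply/prodf_neq0 => i _. Qed.

Lemma triangle_sqr x : T x ^+ 2 = p ^+ (x * x) * p ^+ x.
Proof.
elim: x => [|x IH]; first by rewrite /T big_ord0 expr1n mulr1.
by rewrite /T big_ord_recr /= -/(T x) exprMn IH -exprM -!exprD; congr (_ ^+ _); lia.
Qed.

(** Reversing the order of the factors turns negative powers of [p] into a symbol with base [p]. It
    serves for [e = a] (the test polynomial at [1/b]) and for [e = 1] (the symbol [(p^-x;p)_x]). *)
Lemma prod_exp_reverse x e : e != 0 ->
  \prod_(i < x) (1 - p ^+ i / (e * p ^+ x)) = (- e^-1) ^+ x / T x * qpoch (e * p) p x.
Proof.
move=> e0; rewrite (reindex_inj rev_ord_inj) /= /T -prodfV.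
rewrite -[x in (- e^-1) ^+ x]card_ord -prodr_const -!big_split /=.
apply: eq_bigr => i _.
have -> : p ^+ x = p ^+ (x - i.+1) * p ^+ i.+1 by rewrite -exprD subnK.
by rewrite exprS; field; rewrite e0 p_neq0 !pX_neq0.
Qed.

(** For [l = x] the telescoping stops one factor short and leaves [1 / (1 - b X)] with
    [b = a c p^x]. Expressing the value through leading coefficients lets it pass to any other
    polynomial of degree [x]. *)
Lemma test_jacobi_diag x :
  has_sum (fun n => weight n * (test x).[p ^+ n] * (jacobi x).[p ^+ n])
    ((test x)`_x / (jacobi x)`_x / dual_weight x).
Proof.
have := @test_jacobi_sum x x; congr has_sum.
rewrite coef_jacobi coef_linprod.
have ap0 : 0 < qpoch_inf (a * p) p by exact: qpoch_inf_gt0.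
(* For [x = 0] the number [b = a c] may reach or exceed 1, so that [1 - b] may vanish; this is also
   the separate case of [dual_weight]. *)
have [->|x0] := posnP x.
  rewrite big_ord1 /jacobi_coef /dual_weight /= ?qpoch0 ?big_ord0 ?expr0 ?qpoch0 ?expr1 ?mulr1 ?divr1.
  have h1 : 0 < qpoch_inf (a * c * p) p.
    by apply: qpoch_inf_gt0; rewrite // -[p]expr1 ?acpX_ge0 ?acpX_lt1.
  by field; rewrite !gt_eqF.
set b := a * c * p ^+ x.
have b0 : 0 <= b by exact: acpX_ge0.
have b1 : b < 1 by exact: acpX_lt1.
have b_neq0 : b != 0 by rewrite !mulf_neq0.
have bj j : 1 - b * p ^+ j != 0 by rewrite gt_eqF // factor_gt0.
(* Division at the pole [1/b]: the quotient [Q] has degree below [x] and is killed by the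
   difference, so only the constant [t0] over [1 - b X] remains. *)
have [Q QE] : exists Q : {poly R}, test x - (test x).[b^-1]%:P = Q * ('X - b^-1%:P).
  by apply/factor_theorem; rewrite /root !hornerE subrr.
have sQ : (size Q <= x)%N.
  have [->|Q0] := eqVneq Q 0; first by rewrite size_poly0.
  have := congr1 (fun P : {poly R} => size P) QE.
  rewrite size_Mmonic ?monicXsubC // size_XsubC addn2 /= => sQ.
  rewrite -ltnS -sQ (leq_trans (size_polyD _ _)) // geq_max size_linprod size_polyN.
  by rewrite (leq_trans (size_polyC_leq1 _)).
pose ratio := qpoch_inf b p / qpoch_inf (a * p) p.
pose t0 := (test x).[b^-1].
transitivity (ratio * (t0 * (qpoch p p x * b ^+ x / qpoch b p x.+1))).
  have := @qdiff_pole _ _ p_gt0 x b 0%N bj; rewrite expr0 mulr1 => <-.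
  have := qdiff_poly p_gt0 p_lt1 sQ; rewrite !qdiffE // => Q0.
  rewrite -[RHS]addr0 -[X in _ = _ + X](mulr0 (- (ratio * b^-1))) -[X in _ = _ + _ * X]Q0.
  rewrite !mulr_sumr -big_split; apply: eq_bigr => j _ /=.
  rewrite !add0n -horner_test.
  have -> : (test x).[p ^+ j] = t0 + Q.[p ^+ j] * (p ^+ j - b^-1).
    have := congr1 (fun P : {poly R} => P.[p ^+ j]) QE; rewrite /= !hornerE => <-.
    by rewrite addrC subrK.
  have h1 := qpoch_neq0 p_gt0 p_lt1 j p_lt1.
  have h3 := bj j.
  have h4 : qpoch_inf (a * p) p != 0 by rewrite gt_eqF.
  have e : qpoch b p j * qpoch_inf (a * c * p ^+ (j + x).+1) p =
      qpoch_inf b p / (1 - b * p ^+ j).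
    rewrite (qpoch_infD p_gt0 p_lt1 j.+1 b0) // qpochS.
    have -> : b * p ^+ j.+1 = a * c * p ^+ (j + x).+1.
      by rewrite /b -mulrA -exprD addnC.
    by field.
  set C := _ * p ^+ j; set Y := t0 + _.
  transitivity (C * Y / qpoch_inf (a * p) p *
    (qpoch b p j * qpoch_inf (a * c * p ^+ (j + x).+1) p)); first by ring.
  by rewrite e /ratio /Y; field; rewrite h3 h4 b_neq0.
rewrite /t0 horner_linprod.
have -> : \prod_(i < x) (1 - c * p ^+ i * b^-1) = (- a^-1) ^+ x / T x * qpoch (a * p) p x.
  rewrite -prod_exp_reverse //; apply: eq_bigr => i _.
  by rewrite /b; field; rewrite a_neq0 c_neq0 pX_neq0.
have signed (e : R) : \prod_(i < x) (- (e * p ^+ i)) = (- e) ^+ x * (T x / p ^+ x).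
  have -> : p ^+ x = \prod_(i < x) p by rewrite prodr_const card_ord.
  rewrite /T -prodf_div -[x in (- e) ^+ x]card_ord -prodr_const -big_split /=.
  by apply: eq_bigr => i _; rewrite exprS; field.
have -> : \prod_(i < x) (- (c * p ^+ i)) = (- c) ^+ x * (T x / p ^+ x) by exact: signed.
have -> : \prod_(i < x) (- p ^- i) = (-1) ^+ x * (p ^+ x / T x).
  have sign1 : ((-1) ^+ x : R) * (-1) ^+ x = 1 by rewrite -exprMn mulrNN mulr1 expr1n.
  apply: (mulfI (x := \prod_(i < x) (- (1 * p ^+ i)))).
    by apply/prodf_neq0 => i _; rewrite mul1r oppr_eq0.
  rewrite -big_split /= big1 => [|i _].
    have := triangle_neq0 x; rewrite signed => h.
    rewrite mulrACA sign1 mul1r; field; by rewrite h pX_neq0.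
  by rewrite mul1r mulrNN mulfV.
rewrite /jacobi_coef.
have -> : qpoch (p ^- x) p x = (-1) ^+ x / T x * qpoch p p x.
  have := prod_exp_reverse x (oner_neq0 R); rewrite invr1 !mul1r => <-.
  by apply: eq_bigr => i _; rewrite mulrC.
rewrite /dual_weight gtn_eqF //.
have -> : 1 - a * c * p ^+ (x + x) = 1 - b * p ^+ x by rewrite exprD mulrA.
rewrite -/b /ratio (qpoch_infD p_gt0 p_lt1 1 b0 b1) qpochS qpoch0 expr0 mulr1 mul1r expr1.
rewrite (qpoch_infD p_gt0 p_lt1 x ap_ge0 ap_lt1) qpochS.
rewrite -[a * p * p ^+ x]mulrA -exprS (_ : b * p = a * c * p ^+ x.+1); last first.
  by rewrite exprSr mulrA.
have bx : b ^+ x = a ^+ x * c ^+ x * p ^+ (x * x) by rewrite /b !exprMn -exprM.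
have t2 : p ^+ (x * x) = T x ^+ 2 / p ^+ x by rewrite triangle_sqr mulfK.
rewrite bx t2 -[- a^-1]mulN1r -[- c]mulN1r !exprMn exprVn.
have h1 := qpoch_neq0 p_gt0 p_lt1 x p_lt1.
have h2 := qpoch_neq0 p_gt0 p_lt1 x c_lt1.
have h3 := qpoch_neq0 p_gt0 p_lt1 x ap_lt1.
have h4 := qpoch_neq0 p_gt0 p_lt1 x b1.
have h5 : 1 - b != 0 by have := bj 0%N; rewrite expr0 mulr1.
have h6 := bj x.
have h7 := triangle_neq0 x.
have h8 : qpoch_inf (a * p ^+ x.+1) p != 0.
  rewrite gt_eqF // exprS mulrA; apply: qpoch_inf_gt0; rewrite ?mulr_ge0 ?ltW //.
  by apply: le_lt_trans ap_lt1; rewrite ler_piMr // exp_le1.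
have h9 : qpoch_inf (a * c * p ^+ x.+1) p != 0.
  by rewrite gt_eqF //; apply: qpoch_inf_gt0; rewrite ?acpX_ge0 ?acpX_lt1.
have h10 : a ^+ x != 0 by rewrite expf_neq0.
have h11 : c ^+ x != 0 by rewrite expf_neq0.
have h12 := pX_neq0 x.
move: h1 h2 h3 h4 h5 h6 h7 h8 h9 h10 h11 h12.
rewrite -signr_odd.
case: odd; rewrite ?expr1 ?expr0 => h1 h2 h3 h4 h5 h6 h7 h8 h9 h10 h11 h12;
  by field; rewrite h1 h2 h3 h4 h5 h6 h7 h8 h9 h10 h12.
Qed.

End LittleQJacobi.

(** * Orthogonality of the little q-Jacobi polynomials and bounds on their growth *)

Lemma size_sub_lead (F : fieldType) (P Q : {poly F}) m :
  (size P <= m.+1)%N -> (size Q <= m.+1)%N -> Q`_m != 0 ->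
  (size (P - (P`_m / Q`_m) *: Q)%R <= m)%N.
Proof.
move=> sP sQ Q0; apply/leq_sizeP => i mi; rewrite coefB coefZ.
move: mi; rewrite leq_eqVlt => /predU1P[<-|mi]; first by rewrite divfK // subrr.
by rewrite [P`_i]nth_default ?(leq_trans sP mi) // [Q`_i]nth_default ?(leq_trans sQ mi) // mulr0 subrr.
Qed.

Lemma sum_ord_trunc (V : nmodType) (f : nat -> V) m N : (m <= N)%N ->
  (forall j, (m <= j < N)%N -> f j = 0) -> \sum_(j < N) f j = \sum_(j < m) f j.
Proof.
move=> mN f0; rewrite -!(big_mkord xpredT f) (@big_cat_nat _ _ _ m) //=.
by rewrite [X in _ + X]big_nat_cond [X in _ + X]big1 ?addr0 // => j /andP[jm _]; apply: f0.
Qed.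

Section LittleQJacobiOrthogonality.
Context {R : realType}.
Variables p a c : R.
Hypotheses (p_gt0 : 0 < p) (p_lt1 : p < 1).
Hypotheses (a_gt0 : 0 < a) (ap_lt1 : a * p < 1) (c_gt0 : 0 < c) (c_lt1 : c < 1).
Implicit Types (x n m j l : nat) (A B : R) (F : {poly R}).

Local Notation jac x n := (jacobi p a c x).[p ^+ n].
Local Notation w := (weight p a c).
Local Notation W := (dual_weight p a c).

Let p_neq0 : p != 0. Proof. by rewrite gt_eqF. Qed.
Let pX_gt0 n : 0 < p ^+ n. Proof. exact: exprn_gt0. Qed.
Let pX_neq0 n : p ^+ n != 0. Proof. by rewrite expf_neq0. Qed.
Let ap_gt0 : 0 < a * p. Proof. by rewrite mulr_gt0. Qed.
Let qp_gt0 n : 0 < qpoch p p n. Proof. exact: qpoch_gt0. Qed.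
Let qc_gt0 n : 0 < qpoch c p n. Proof. exact: qpoch_gt0. Qed.

Lemma weight_gt0 n : 0 < w n.
Proof. by rewrite /weight mulr_gt0 ?exprn_gt0 // divr_gt0. Qed.

Lemma dual_weight_gt0 x : 0 < W x.
Proof.
rewrite /dual_weight !mulr_gt0 ?invr_gt0 ?exprn_gt0 //.
- case: posnP => // x0; rewrite divr_gt0 // subr_gt0 acpX_lt1 //.
  by rewrite addn_gt0 x0.
- apply: qpoch_inf_gt0 => //; first by rewrite mulr_ge0 // ltW.
  by rewrite exprS mulrA (le_lt_trans _ ap_lt1) // ler_piMr ?exp_le1 // ltW.
- by apply: qpoch_inf_gt0; rewrite ?acpX_ge0 ?acpX_lt1.
Qed.

Lemma lead_jacobi_neq0 x : (jacobi p a c x)`_x != 0.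
Proof.
rewrite coef_jacobi mulf_neq0 //; last first.
  by apply/prodf_neq0 => i _; rewrite oppr_eq0 invr_eq0.
have ax0 : a ^+ x != 0 by rewrite expf_neq0 // gt_eqF.
have h1 : qpoch (p ^- x) p x != 0.
  apply/prodf_neq0 => i _; rewrite subr_eq0 eq_sym mulrC.
  rewrite -[X in _ != X](mulfV (pX_neq0 x)) (inj_eq (mulIf _)) ?invr_eq0 //.
  have : p ^+ x < p ^+ i by rewrite ltr_iXn2l.
  by rewrite lt_neqAle eq_sym => /andP[].
have h2 : qpoch (a * c * p ^+ x) p x != 0.
  case: x {ax0 h1} => [|x]; first by rewrite qpoch0 oner_neq0.
  by rewrite gt_eqF // qpoch_gt0 ?acpX_lt1.
have h3 := qp_gt0 x; have h4 := qc_gt0 x.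
by rewrite /jacobi_coef !mulf_neq0 // invr_eq0 !mulf_neq0 // gt_eqF.
Qed.

Lemma lead_test_neq0 x : (linprod x (fun i => c * p ^+ i))`_x != 0.
Proof.
by rewrite coef_linprod; apply/prodf_neq0 => i _; rewrite oppr_eq0 mulf_neq0 // gt_eqF.
Qed.

(** The test polynomials of degree below [x] span: subtracting a multiple of [test m] lowers the
    degree by one at each step. *)
Lemma jacobi_orth_low x F : (size F <= x)%N -> has_sum (fun n => w n * F.[p ^+ n] * jac x n) 0.
Proof.
suff h m : (m <= x)%N -> forall F, (size F <= m)%N ->
    has_sum (fun n => w n * F.[p ^+ n] * jac x n) 0 by exact: h.
elim: m => [_ G|m IH mx G sG].
  rewrite leqn0 size_poly_eq0 => /eqP ->.
  by apply: eq_has_sum has_sum0 => n; rewrite horner0 mulr0 mul0r.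
have h1 := IH (ltnW mx) _ (size_sub_lead sG (size_linprod _ _) (lead_test_neq0 m)).
set r := _ / _ in h1.
have h2 := has_sumZ (c := r) (test_jacobi_orth p_gt0 p_lt1 a_gt0 ap_lt1 c_gt0 c_lt1 mx).
have := has_sumD h1 h2; rewrite mulr0 addr0; apply: eq_has_sum => n.
by rewrite hornerD hornerN hornerZ; ring.
Qed.

(** By the previous lemma only the leading coefficient of [F] matters, and [test x] supplies the
    normalisation. *)
Lemma jacobi_orth_top x F : (size F <= x.+1)%N ->
  has_sum (fun n => w n * F.[p ^+ n] * jac x n) (F`_x / (jacobi p a c x)`_x / W x).
Proof.
move=> sF; have := size_sub_lead sF (size_linprod _ _) (lead_test_neq0 x).
move=> /jacobi_orth_low h1; set r := _ / _ in h1.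
have h2 := has_sumZ (c := r) (@test_jacobi_diag _ _ _ _ p_gt0 p_lt1 a_gt0 ap_lt1 c_gt0 c_lt1 x).
have := has_sumD h1 h2; rewrite add0r.
rewrite (_ : r * _ = F`_x / (jacobi p a c x)`_x / W x).
  by apply: eq_has_sum => n; rewrite hornerD hornerN hornerZ; ring.
rewrite /r; field; rewrite lead_test_neq0 lead_jacobi_neq0.
by rewrite (gt_eqF (dual_weight_gt0 _)).
Qed.

Lemma jacobi_orth x x' :
  has_sum (fun n => w n * jac x n * jac x' n) ((x == x')%:R / W x).
Proof.
have [xx'|xx'|<-] := ltngtP x x'; rewrite ?mul0r.
- by apply: jacobi_orth_low; rewrite (leq_trans (size_jacobi _ _ _ _)).
- have : (size (jacobi p a c x') <= x)%N by rewrite (leq_trans (size_jacobi _ _ _ _)).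
  by move=> /jacobi_orth_low; apply: eq_has_sum => n; rewrite mulrAC.
- by have := jacobi_orth_top (size_jacobi p a c x); rewrite divff ?lead_jacobi_neq0.
Qed.

Lemma jacobi_expansion N F : (size F <= N)%N ->
  exists u : nat -> R, F = \sum_(x < N) u x *: jacobi p a c x.
Proof.
elim: N F => [|N IH] F sF.
  by exists (fun=> 0); rewrite big_ord0; apply/eqP; rewrite -size_poly_eq0 -leqn0.
have [u uE] := IH _ (size_sub_lead sF (size_jacobi p a c N) (lead_jacobi_neq0 N)).
exists (fun x => if (x < N)%N then u x else F`_N / (jacobi p a c N)`_N).
rewrite big_ord_recr /= ltnn; apply/eqP; rewrite -subr_eq; apply/eqP; rewrite uE.
by apply: eq_bigr => i _; rewrite ltn_ord.
Qed.

(* [majorant x j] is the size of the term of index [j] of [jacobi x]. Since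
   [a p < 1] it increases geometrically in [j <= x], so the last nonzero term,
   [j = minn n x], dominates at [X = p^n]. *)
Definition majorant x j : R := \prod_(i < j) (p ^+ i / (a * p ^+ x)).

Lemma majorantS x j : majorant x j.+1 = majorant x j * (p ^+ j / (a * p ^+ x)).
Proof. by rewrite /majorant big_ord_recr. Qed.

Lemma majorant_gt0 x j : 0 < majorant x j.
Proof. by apply: prodr_gt0 => i _; rewrite divr_gt0 ?mulr_gt0. Qed.

Lemma qpoch_falling_norm_le1 n j : `|qpoch (p ^+ n) p^-1 j| <= 1.
Proof.
have [jn|nj] := leqP j n; last by rewrite qpoch_falling0 // normr0 ler01.
rewrite normr_prod; apply: prodr_ile1 => i _; rewrite normr_ge0 /=.
have iN : (i <= n)%N by rewrite (leq_trans (ltnW (ltn_ord i))).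
have -> : p ^+ n * p^-1 ^+ i = p ^+ (n - i) by rewrite exprVn -expfB_cond ?(negbTE p_neq0) .
rewrite ger0_norm ?gerBl ?subr_ge0 ?exp_le1 //.
exact: ltW.
Qed.

Let K1 : R := (qpoch_inf c p * qpoch_inf p p)^-1.

Let K1_gt0 : 0 < K1.
Proof. by rewrite invr_gt0 mulr_gt0 // qpoch_inf_gt0 // ltW. Qed.

(** For [i < j <= x] one has [|1 - p^(i-x)| <= p^(i-x)], and these factors divided by [a^j] form the
    majorant. The symbol in [a c p^x] is at most 1, and those in the denominator are at least their
    infinite products, whence [K1]. *)
Lemma jacobi_coef_le x j : (j <= x)%N -> `|jacobi_coef p a c x j| <= K1 * majorant x j.
Proof.
move=> jx; rewrite /jacobi_coef.
have ax0 : 0 < a ^+ j by rewrite exprn_gt0.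
have h1 : `|qpoch (p ^- x) p j| <= \prod_(i < j) (p ^+ i / p ^+ x).
  rewrite normr_prod; apply: ler_prod => i _; rewrite normr_ge0 /= mulrC distrC.
  have : 1 <= p ^+ i / p ^+ x.
    rewrite ler_pdivlMr // mul1r ler_wiXn2l ?ltW //.
    by rewrite (leq_trans (ltnW (ltn_ord i))).
  by move=> h; rewrite ger0_norm ?subr_ge0 // gerBl ler01.
have h2 : `|qpoch (a * c * p ^+ x) p j| <= 1.
  (* At [x = 0] the base [a c] may exceed 1, but then [j = 0] and the symbol is empty. *)
  case: j jx {ax0 h1} => [|j] jx; first by rewrite qpoch0 normr1.
  have x0 : (0 < x)%N by apply: leq_trans jx.
  have b1 := acpX_lt1 p_gt0 p_lt1 a_gt0 ap_lt1 c_gt0 c_lt1 x0.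
  rewrite ger0_norm; first by apply: qpoch_le1; rewrite // acpX_ge0.
  by rewrite ltW // qpoch_gt0.
have -> : majorant x j = \prod_(i < j) (p ^+ i / p ^+ x) / a ^+ j.
  rewrite /majorant -[j in a ^+ j]card_ord -prodr_const -prodf_div.
  by apply: eq_bigr => i _; field; rewrite gt_eqF // pX_neq0.
rewrite normrM normfV [X in _ / X]gtr0_norm ?mulr_gt0 // normrM.
rewrite -[a ^+ j * _ * _]mulrA invfM [leLHS]mulrA [leRHS]mulrC.
have h3 : (qpoch c p j * qpoch p p j)^-1 <= K1.
  have h4 := qpoch_inf_le p_gt0 p_lt1 j (ltW c_gt0) c_lt1.
  have h5 := qpoch_inf_le p_gt0 p_lt1 j (ltW p_gt0) p_lt1.
  have h6 := qpoch_inf_gt0 p_gt0 p_lt1 (ltW c_gt0) c_lt1.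
  have h7 := qpoch_inf_gt0 p_gt0 p_lt1 (ltW p_gt0) p_lt1.
  rewrite /K1 lef_pV2 ?posrE ?mulr_gt0 //.
  by apply: (ler_pM (ltW h6) (ltW h7) h4 h5).
have h4 := ltW (qc_gt0 j); have h5 := ltW (qp_gt0 j).
apply: ler_pM h3.
- by rewrite divr_ge0 ?mulr_ge0 // ltW.
- by rewrite invr_ge0 mulr_ge0.
- rewrite ler_pM2r ?invr_gt0 // -[leRHS]mulr1.
  by apply: ler_pM.
Qed.

Lemma majorant_sum_le x m : (m <= x)%N ->
  \sum_(j < m.+1) majorant x j <= majorant x m / (1 - a * p).
Proof.
have q0 : 0 < 1 - a * p by rewrite subr_gt0.
elim: m => [_|m IH mx].
  by rewrite big_ord1 ler_pdivlMr // ler_piMr ?ltW ?majorant_gt0 // gtrBl.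
rewrite big_ord_recr /=; apply: le_trans (lerD (IH (ltnW mx)) (lexx _)) _.
have h : majorant x m <= a * p * majorant x m.+1.
  rewrite majorantS mulrCA -[leLHS]mulr1 ler_pM2l ?majorant_gt0 //.
  rewrite (_ : _ * (_ / _) = p ^+ m.+1 / p ^+ x); last first.
    by rewrite exprS; field; rewrite pX_neq0 gt_eqF.
  by rewrite ler_pdivlMr // mul1r ler_wiXn2l // ltW.
rewrite -subr_ge0 (_ : _ - _ = (a * p * majorant x m.+1 - majorant x m) / (1 - a * p)).
  by rewrite divr_ge0 ?subr_ge0 // ltW.
by field; rewrite gt_eqF.
Qed.

Definition jacobi_const : R := K1 / (1 - a * p).

Lemma jacobi_const_gt0 : 0 < jacobi_const.
Proof. by rewrite divr_gt0 // subr_gt0. Qed.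

Lemma jacobi_le x n : `|jac x n| <= jacobi_const * majorant x (minn n x).
Proof.
rewrite horner_jacobi.
rewrite (@sum_ord_trunc _ (fun j => jacobi_coef p a c x j * qpoch (p ^+ n) p^-1 j)
  (minn n x).+1) ?ltnS ?geq_minr //; last first.
  move=> j /andP[h1 h2]; rewrite qpoch_falling0 ?mulr0 //.
  by move: h1; rewrite gtn_min => /orP[//|]; rewrite ltnNge -ltnS h2.
apply: le_trans (ler_norm_sum _ _ _) _.
apply: le_trans (_ : \sum_(j < (minn n x).+1) K1 * majorant x j <= _).
  apply: ler_sum => j _; rewrite normrM -[leRHS]mulr1.
  apply: ler_pM => //; last exact: qpoch_falling_norm_le1.
  by apply: jacobi_coef_le; rewrite (leq_trans _ (geq_minr n x)) // -ltnS.
rewrite -mulr_sumr /jacobi_const -[leRHS]mulrA ler_pM2l // [leRHS]mulrC.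
by apply: majorant_sum_le; exact: geq_minr.
Qed.

(** The first summand accounts for the nodes [n < x], the second for [n >= x]. *)
Definition majorant_bound A : R := (1 - p)^-1 + (1 - A)^-1.

Lemma majorant_bound_gt0 A : A < 1 -> 0 < majorant_bound A.
Proof. by move=> A1; rewrite addr_gt0 // invr_gt0 subr_gt0. Qed.

(** The terms peak at [n = x]: below [x] they increase, because [A >= a p], and above [x] they decay
    with ratio [A]. *)
Lemma majorant_gen_le A x N : a * p <= A -> A < 1 ->
  \sum_(n < N) A ^+ n * majorant x (minn n x) <=
  majorant_bound A * (A ^+ x * majorant x x).
Proof.
move=> apA A1.
have A0 : 0 < A by apply: lt_le_trans apA.
have q0 : 0 < 1 - p by rewrite subr_gt0.
have A'0 : 0 < 1 - A by rewrite subr_gt0.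
pose g n := A ^+ n * majorant x (minn n x).
have g0 n : 0 < g n by rewrite mulr_gt0 ?exprn_gt0 ?majorant_gt0.
have gS m : (m < x)%N -> g m <= p ^+ (x - m.+1) * g m.+1.
  move=> mx; rewrite /g (minn_idPl mx) (minn_idPl (ltnW mx)) majorantS.
  have -> : p ^+ x = p ^+ (x - m.+1) * p ^+ m.+1 by rewrite -exprD subnK.
  rewrite [p ^+ m.+1]exprS [A ^+ m.+1]exprS.
  rewrite (_ : _ * (_ * _) = A ^+ m * majorant x m * (A / (a * p))); last first.
    by field; rewrite !pX_neq0 p_neq0 gt_eqF.
  have h1 : 1 <= A / (a * p) by rewrite ler_pdivlMr // mul1r.
  have h2 : 0 <= A ^+ m * majorant x m by rewrite ltW // mulr_gt0 ?exprn_gt0 ?majorant_gt0.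
  exact: ler_peMr.
have low m : (m < x)%N -> \sum_(n < m.+1) g n <= g m / (1 - p).
  elim: m => [_|m IH mx].
    by rewrite big_ord1 ler_pdivlMr // ler_piMr ?ltW // gtrBl.
  rewrite big_ord_recr /=; apply: le_trans (lerD (IH (ltnW mx)) (lexx _)) _.
  have h : g m <= p * g m.+1.
    apply: le_trans (gS _ (ltnW mx)) _; rewrite (ler_pM2r (g0 _)).
    by rewrite -(subnSK mx) exprS ler_piMr ?exp_le1 // ltW.
  rewrite -subr_ge0 (_ : _ - _ = (p * g m.+1 - g m) / (1 - p)).
    by rewrite divr_ge0 ?subr_ge0 // ltW.
  by field; rewrite gt_eqF.
(* From [x - 1] to [x] the ratio is only known to be at most [p^0 = 1], so the geometric sum is
   closed at [x - 1] and then compared with [g x]. *)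
have low' : \sum_(n < x) g n <= g x / (1 - p).
  case: (posnP x) => [->|x0]; first by rewrite big_ord0 divr_ge0 // ltW.
  have xx : (x.-1 < x)%N by rewrite prednK.
  have := low _ xx; rewrite prednK // => lowx; apply: le_trans lowx _.
  rewrite ler_pM2r ?invr_gt0 //.
  by have := gS _ xx; rewrite prednK // subnn expr0 mul1r.
apply: le_trans (_ : \sum_(n < x + N) g n <= _).
  rewrite -!(big_mkord xpredT g) [leRHS](@big_cat_nat _ _ _ N) ?leq_addl //= lerDl.
  by apply: sumr_ge0 => i _; rewrite ltW.
rewrite big_split_ord /= mulrDl.
have -> : A ^+ x * majorant x x = g x by rewrite /g minnn.
apply: lerD; first by rewrite mulrC.
have hA : `|A| < 1 by rewrite gtr0_norm.
rewrite mulrC; apply: le_trans (has_sum_partial_le N _ (has_sum_geometric (c := g x) hA)).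
  by apply: ler_sum => i _; rewrite /g minnn (minn_idPr (leq_addr _ _)) exprD mulrAC.
by move=> i; rewrite mulr_ge0 ?exprn_ge0 ?ltW.
Qed.

(** The bound is uniform in [N], so it covers the truncations in the dominated convergence argument
    as well as the full sums. *)
Lemma jacobi_partial_sum_le A C (u : nat -> R) x N : a * p <= A -> A < 1 ->
  (forall n, `|u n| <= C * A ^+ n) ->
  \sum_(n < N) `|u n * jac x n| <= C * jacobi_const * majorant_bound A * (A ^+ x * majorant x x).
Proof.
move=> apA A1 uC.
have C0 : 0 <= C by have := uC 0%N; rewrite expr0 mulr1; apply: le_trans.
apply: le_trans (_ : \sum_(n < N) C * jacobi_const * (A ^+ n * majorant x (minn n x)) <= _).
  apply: ler_sum => n _; rewrite normrM mulrACA; apply: ler_pM => //.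
  exact: jacobi_le.
rewrite -mulr_sumr -[leRHS]mulrA; apply: ler_wpM2l; first by rewrite mulr_ge0 // ltW // jacobi_const_gt0.
exact: majorant_gen_le.
Qed.

(** Since [majorant x x] is [p^(-x(x+1)/2) a^(-x)], the Gaussian factor of the dual weight cancels
    that of the square and only a geometric factor survives. *)
Lemma majorant_sqr x : majorant x x ^+ 2 * (p ^+ (x * x) * a ^+ x) = (a * p) ^- x.
Proof.
have e : (\prod_(i < x) p ^+ i) ^+ 2 * p ^+ x = p ^+ (x * x).
  elim: x => [|x IH]; first by rewrite big_ord0 mul0n !expr0 expr1n mulr1.
  rewrite big_ord_recr /= (_ : (x.+1 * x.+1 = x * x + x + x.+1)%N); last first.
    by rewrite mulSn mulnS addnC [(x + _)%N]addnC.
  by rewrite !exprD -IH exprMn; ring.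
have -> : majorant x x = (\prod_(i < x) p ^+ i) / (a ^+ x * p ^+ (x * x)).
  rewrite /majorant exprM -exprMn -[X in (a * p ^+ x) ^+ X]card_ord -prodr_const -prodf_div.
  by [].
have ax0 : a ^+ x != 0 by rewrite expf_neq0 // gt_eqF.
rewrite -e [(a * p) ^+ x]exprMn; set Q := \prod_(i < x) p ^+ i.
have Q0 : Q != 0 by apply/prodf_neq0 => i _.
by field; rewrite Q0 ax0 pX_neq0.
Qed.

(** One factor for each of the finite symbol ratio, the leading fraction and the ratio of infinite
    products in [dual_weight]. *)
Definition dual_weight_const : R := (qpoch_inf p p)^-1 / (1 - a * c * p) / qpoch_inf (a * c * p) p.

Let acp_ge0 : 0 <= a * c * p.
Proof. by have := acpX_ge0 p_gt0 a_gt0 c_gt0 1; rewrite expr1. Qed.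

Let acp_lt1 : a * c * p < 1.
Proof. by have := acpX_lt1 p_gt0 p_lt1 a_gt0 ap_lt1 c_gt0 c_lt1 (ltnSn 0); rewrite expr1. Qed.

Lemma dual_weight_const_gt0 : 0 < dual_weight_const.
Proof.
have h1 := qpoch_inf_gt0 p_gt0 p_lt1 (ltW p_gt0) p_lt1.
have h2 := qpoch_inf_gt0 p_gt0 p_lt1 acp_ge0 acp_lt1.
by rewrite /dual_weight_const !mulr_gt0 ?invr_gt0 // subr_gt0.
Qed.

Lemma dual_weight_le x : W x <= dual_weight_const * (p ^+ (x * x) * a ^+ x).
Proof.
rewrite /dual_weight ler_pM2r; last by rewrite mulr_gt0 ?exprn_gt0.
have b0 := acpX_ge0 p_gt0 a_gt0 c_gt0.
have b1 := acpX_lt1 p_gt0 p_lt1 a_gt0 ap_lt1 c_gt0 c_lt1.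
have acpx_le n : a * c * p ^+ n.+1 <= a * c * p.
  by rewrite exprS mulrA ler_piMr // exp_le1.
have q0 : 0 < 1 - a * c * p by rewrite subr_gt0.
have h1 : (if x == 0%N then 1 else (1 - a * c * p ^+ (x + x)) / (1 - a * c * p ^+ x)) <=
    (1 - a * c * p)^-1.
  case: (posnP x) => [_|x0].
    by rewrite -[leLHS]invr1 lef_pV2 ?posrE // gerBl.
  have d0 : 0 < 1 - a * c * p ^+ x by rewrite subr_gt0 b1.
  rewrite ler_pdivrMr //; apply: (@le_trans _ _ 1); first by rewrite gerBl.
  rewrite mulrC ler_pdivlMr // mul1r lerD2l lerN2.
  by case: (x) x0 => // n _; exact: acpx_le.
have h1' : 0 <= (if x == 0%N then 1 else (1 - a * c * p ^+ (x + x)) / (1 - a * c * p ^+ x)).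
  case: (posnP x) => [_|x0]; first exact: ler01.
  by rewrite divr_ge0 // subr_ge0 ltW // b1 // addn_gt0 x0.
have /andP[h2' h2] := qpoch_ratio_le p_gt0 p_lt1 x (ltW c_gt0) c_lt1.
have e0 : 0 <= a * p ^+ x.+1 by rewrite mulr_ge0 // ltW.
have e1 : a * p ^+ x.+1 < 1.
  by rewrite exprS mulrA (le_lt_trans _ ap_lt1) // ler_piMr ?exp_le1 // ltW.
have h3' : 0 <= qpoch_inf (a * p ^+ x.+1) p / qpoch_inf (a * c * p ^+ x.+1) p.
  by rewrite divr_ge0 // ltW // qpoch_inf_gt0 // b1.
have h3 : qpoch_inf (a * p ^+ x.+1) p / qpoch_inf (a * c * p ^+ x.+1) p <=
    (qpoch_inf (a * c * p) p)^-1.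
  rewrite ler_pdivrMr; last by rewrite qpoch_inf_gt0 ?b1.
  apply: (@le_trans _ _ 1); first by rewrite qpoch_inf_le1.
  rewrite mulrC ler_pdivlMr; last by rewrite qpoch_inf_gt0.
  rewrite mul1r (qpoch_infD p_gt0 p_lt1 x acp_ge0 acp_lt1).
  rewrite (_ : a * c * p * p ^+ x = a * c * p ^+ x.+1); last by rewrite exprS mulrA.
  apply: ler_piMl; first by rewrite ltW // qpoch_inf_gt0 // b1.
  by apply: qpoch_le1.
rewrite /dual_weight_const [_^-1 / (1 - _)]mulrC.
apply: ler_pM h3 => //; first by rewrite mulr_ge0.
exact: ler_pM.
Qed.

Lemma dual_weight_majorant_le A B x : 0 <= A -> 0 <= B ->
  W x * ((A ^+ x * majorant x x) * (B ^+ x * majorant x x)) <= dual_weight_const * (A * B / (a * p)) ^+ x.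
Proof.
move=> A0 B0.
have -> : dual_weight_const * (A * B / (a * p)) ^+ x = dual_weight_const * (p ^+ (x * x) * a ^+ x) *
    ((A ^+ x * majorant x x) * (B ^+ x * majorant x x)).
  rewrite exprMn exprVn -majorant_sqr exprMn; ring.
have M0 := ltW (majorant_gt0 x x).
by apply: ler_wpM2r (dual_weight_le x); rewrite !mulr_ge0 ?exprn_ge0.
Qed.

End LittleQJacobiOrthogonality.

(** * Completeness and the Parseval identity *)

Section LittleQJacobiCompleteness.
Local Open Scope classical_set_scope.
Local Open Scope ring_scope.
Context {R : realType}.
Variables p a c : R.
Hypotheses (p_gt0 : 0 < p) (p_lt1 : p < 1).
Hypotheses (a_gt0 : 0 < a) (ap_lt1 : a * p < 1) (c_gt0 : 0 < c) (c_lt1 : c < 1).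
Implicit Types (x n m j : nat) (A B l : R) (F : {poly R}) (u v : nat -> R).

Local Notation jac x n := (jacobi p a c x).[p ^+ n].
Local Notation w := (weight p a c).
Local Notation W := (dual_weight p a c).
Local Notation K2 := (jacobi_const p a c).
Local Notation K4 := (dual_weight_const p a c).
Local Notation mb A := (majorant_bound p A).
Local Notation maj x := (majorant p a x x).

Let p_neq0 : p != 0. Proof. by rewrite gt_eqF. Qed.
Let pX_gt0 n : 0 < p ^+ n. Proof. exact: exprn_gt0. Qed.
Let pX_neq0 n : p ^+ n != 0. Proof. by rewrite expf_neq0. Qed.
Let ap_gt0 : 0 < a * p. Proof. by rewrite mulr_gt0. Qed.
Let w_gt0 n : 0 < w n. Proof. exact: weight_gt0. Qed.
Let W_gt0 x : 0 < W x. Proof. exact: dual_weight_gt0. Qed.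
Let K2_gt0 : 0 < K2. Proof. exact: jacobi_const_gt0. Qed.
Let K4_gt0 : 0 < K4. Proof. exact: dual_weight_const_gt0. Qed.
Let maj_gt0 x : 0 < maj x. Proof. exact: majorant_gt0. Qed.
Let C0 : R := (qpoch_inf p p)^-1.
Let C0_gt0 : 0 < C0. Proof. by rewrite invr_gt0 qpoch_inf_gt0 // ltW. Qed.

Lemma weight_le n : w n <= C0 * (a * p) ^+ n.
Proof.
rewrite /weight mulrC ler_pM2r ?exprn_gt0 //.
by have /andP[] := qpoch_ratio_le p_gt0 p_lt1 n (ltW c_gt0) c_lt1.
Qed.

Lemma jacobi_sum_le A C u x l : a * p <= A -> A < 1 ->
  (forall n, `|u n| <= C * A ^+ n) -> has_sum (fun n => u n * jac x n) l ->
  `|l| <= C * K2 * mb A * (A ^+ x * maj x).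
Proof.
move=> apA A1 uC; apply: has_sum_partial_bound => N.
exact: jacobi_partial_sum_le.
Qed.

(** The sum bound applied to the unit sequence at [m], with the smallest admissible rate [A = a p].
    The constant depends on [m], but the dependence on [x] has the shape that
    [dual_weight_majorant_le] requires. *)
Lemma jacobi_pointwise_le x m : `|jac x m| <= (a * p) ^- m * K2 * mb (a * p) * ((a * p) ^+ x * maj x).
Proof.
have h := @has_sum_delta _ m (fun n => jac x n).
apply: (jacobi_sum_le (lexx _) ap_lt1 _ h) => n.
case: eqVneq => [->|_]; first by rewrite mulVf ?normr1 // expf_neq0 // gt_eqF.
by rewrite normr0 mulr_ge0 ?invr_ge0 ?exprn_ge0 // ltW.
Qed.

Section DeltaApproximation.
Variable n : nat.

Let K : R := (qpoch p p n)^-1.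
Let K_gt0 : 0 < K. Proof. by rewrite invr_gt0 qpoch_gt0. Qed.

(* [(X / p^n)^N] tends to [0] at the nodes [p^m], [m > n], and [newton n] vanishes
   at the nodes with [m < n]. *)
Definition delta_approx N : {poly R} := K *: (newton p n * (p ^- n *: 'X) ^+ N).

Lemma horner_delta_approx N m :
  (delta_approx N).[p ^+ m] = K * (qpoch (p ^+ m) p^-1 n * (p ^+ m / p ^+ n) ^+ N).
Proof.
by rewrite hornerZ hornerM horner_newton horner_exp hornerZ hornerX [p ^- n * _]mulrC.
Qed.

Lemma size_delta_approx N : (size (delta_approx N) <= (n + N).+1)%N.
Proof.
rewrite (leq_trans (size_scale_leq _ _)) // (leq_trans (size_polyMleq _ _)) //.
have sX : (size ((p ^- n *: 'X) ^+ N : {poly R}) <= N.+1)%N.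
  by rewrite exprZn (leq_trans (size_scale_leq _ _)) // size_polyXn.
rewrite -subn1 leq_subLR (leq_trans (leq_add (size_linprod n _) sX)) //.
by rewrite addSn addnS.
Qed.

Lemma delta_approx_dist N m : `|(delta_approx N).[p ^+ m] - (m == n)%:R| <= K * p ^+ N.
Proof.
have K0 := ltW K_gt0; have pN0 := ltW (pX_gt0 N).
rewrite horner_delta_approx; have [mn|nm|->] := ltngtP m n.
- by rewrite qpoch_falling0 // mul0r mulr0 subrr normr0 mulr_ge0.
- rewrite subr0 normrM (ger0_norm K0) ler_pM2l // normrM -[leRHS]mul1r.
  apply: ler_pM => //; first exact: qpoch_falling_norm_le1.
  have d0 := ltW (pX_gt0 (m - n)); have p0 := ltW p_gt0.
  rewrite -expfB // ger0_norm ?exprn_ge0 // lerXn2r ?nnegrE //.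
  by rewrite -[leRHS]expr1 ler_wiXn2l ?subn_gt0 // ltW.
- rewrite divff // expr1n mulr1.
  have := qpoch_falling p_gt0 0 n; rewrite add0n qpoch0 mulr1 => ->.
  by rewrite mulVf ?subrr ?normr0 ?mulr_ge0 // gt_eqF // qpoch_gt0.
Qed.

(** The approximant has degree at most [n + N], hence a finite expansion with coefficients [u x]. By
    orthogonality [u x] is close to [W x * w n * jac x n], the coefficient of the point mass itself.
    The two summands of the constant are the errors at the node [p^m] and in the coefficients; the
    latter are summed over [x] by means of [W x ((a p)^x maj x)^2 <= K4 (a p)^x]. *)
Lemma delta_expansion_dist N m :
  `|\sum_(x < (n + N).+1) W x * jac x n * jac x m - (n == m)%:R / w n| <=
  (K + C0 * K * K2 * mb (a * p) * ((a * p) ^- m * K2 * mb (a * p)) * (K4 / (1 - a * p))) /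
    w n * p ^+ N.
Proof.
have pN0 := ltW (pX_gt0 N).
have [u uE] := jacobi_expansion p_gt0 p_lt1 a_gt0 ap_lt1 c_gt0 c_lt1 (size_delta_approx N).
have FE i : (delta_approx N).[p ^+ i] = \sum_(x < (n + N).+1) u x * jac x i.
  by rewrite uE horner_sum; apply: eq_bigr => y _; rewrite hornerZ.
set E := C0 * K * K2 * mb (a * p); set E' := _ * K2 * mb (a * p).
have mb0 := majorant_bound_gt0 p_lt1 ap_lt1.
have E0 : 0 <= E.
  by apply: mulr_ge0 (ltW mb0); apply: mulr_ge0 (ltW K2_gt0); rewrite mulr_ge0 ?ltW.
have E'0 : 0 <= E'.
  apply: mulr_ge0 (ltW mb0); apply: mulr_ge0 (ltW K2_gt0).
  by rewrite invr_ge0 exprn_ge0 // ltW.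
have coef_dist x : (x < (n + N).+1)%N ->
    `|u x - W x * w n * jac x n| <= W x * (E * p ^+ N * ((a * p) ^+ x * maj x)).
  move=> xN.
  have h1 : has_sum (fun i => w i * (delta_approx N).[p ^+ i] * jac x i) (u x / W x).
    have h := @has_sum_sum _ (n + N).+1
      (fun y i => u y * (w i * jac y i * jac x i)) _
      (fun y _ => has_sumZ (c := u y)
         (@jacobi_orth _ _ _ _ p_gt0 p_lt1 a_gt0 ap_lt1 c_gt0 c_lt1 y x)).
    move: h; congr has_sum; last first.
      rewrite (bigD1 (Ordinal xN)) //= eqxx div1r big1 ?addr0 // => i ix.
      by rewrite (_ : (i == x :> nat) = false) ?mul0r ?mulr0 //; apply/negbTE.
    apply/funext => i; rewrite FE mulr_sumr mulr_suml.
    by apply: eq_bigr => y _; ring.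
  have h2 := @has_sum_delta _ n (fun i => w i * jac x i).
  have h3 := has_sumB h1 h2.
  have : has_sum (fun i => (w i * ((delta_approx N).[p ^+ i] - (i == n)%:R)) * jac x i)
      (u x / W x - w n * jac x n).
    by apply: eq_has_sum h3 => i; ring.
  move=> /(jacobi_sum_le (C := C0 * K * p ^+ N) (lexx _) ap_lt1) h4.
  have -> : u x - W x * w n * jac x n = W x * (u x / W x - w n * jac x n).
    by field; rewrite gt_eqF.
  rewrite normrM gtr0_norm // ler_pM2l //; apply: le_trans (h4 _) _; last first.
    by rewrite /E; rewrite le_eqVlt; apply/orP; left; apply/eqP; ring.
  move=> i; rewrite normrM (gtr0_norm (w_gt0 _)).
  apply: le_trans (ler_pM (ltW (w_gt0 i)) (normr_ge0 _) (weight_le i) (delta_approx_dist N i)) _.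
  by rewrite le_eqVlt; apply/orP; left; apply/eqP; ring.
have wn := w_gt0 n.
have -> : \sum_(x < (n + N).+1) W x * jac x n * jac x m - (n == m)%:R / w n =
   (((delta_approx N).[p ^+ m] - (m == n)%:R) -
    \sum_(x < (n + N).+1) (u x - W x * w n * jac x n) * jac x m) / w n.
  under [in RHS]eq_bigr do rewrite mulrBl.
  rewrite sumrB FE.
  rewrite (_ : \sum_(x < (n + N).+1) W x * w n * jac x n * jac x m =
     w n * \sum_(x < (n + N).+1) W x * jac x n * jac x m); last first.
    by rewrite mulr_sumr; apply: eq_bigr => x _; ring.
  by rewrite [m == n]eq_sym; field; rewrite gt_eqF.
rewrite normrM [X in _ * X]gtr0_norm ?invr_gt0 // [leRHS]mulrAC ler_pM2r ?invr_gt0 //.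
apply: le_trans (ler_normB _ _) _; rewrite mulrDl.
apply: lerD; first exact: delta_approx_dist.
apply: le_trans (ler_norm_sum _ _ _) _.
apply: le_trans (_ : \sum_(x < (n + N).+1) E * p ^+ N * E' * (K4 * (a * p) ^+ x) <= _).
  apply: ler_sum => x _; rewrite normrM.
  apply: le_trans (ler_pM _ _ (coef_dist _ (ltn_ord x)) (jacobi_pointwise_le x m)) _ => //.
  have := dual_weight_majorant_le p_gt0 p_lt1 a_gt0 ap_lt1 c_gt0 c_lt1 x (ltW ap_gt0) (ltW ap_gt0).
  rewrite mulfK ?gt_eqF // => h.
  have := ler_wpM2l (mulr_ge0 (mulr_ge0 E0 pN0) E'0) h; apply: le_trans; rewrite -/E' le_eqVlt; apply/orP; left; apply/eqP; ring.
rewrite -mulr_sumr (_ : E * E' * _ * _ = E * p ^+ N * E' * (K4 / (1 - a * p))); last by ring.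
apply: ler_wpM2l; first exact: (mulr_ge0 (mulr_ge0 E0 pN0) E'0).
have hap : `|a * p| < 1 by rewrite gtr0_norm.
apply: has_sum_partial_le (has_sum_geometric hap) => i.
by apply: mulr_ge0; [exact: ltW|rewrite exprn_ge0 // ltW].
Qed.

End DeltaApproximation.

Theorem jacobi_complete n m :
  has_sum (fun x => W x * jac x n * jac x m) ((n == m)%:R / w n).
Proof.
apply: has_sum_dist => e e0.
set D := ((qpoch p p n)^-1 + C0 * (qpoch p p n)^-1 * K2 * mb (a * p) *
   ((a * p) ^- m * K2 * mb (a * p)) * (K4 / (1 - a * p))) / w n.
have lim0 : (fun N => D * p ^+ N) @ \oo --> (0 : R).
  rewrite -[X in _ --> X](mulr0 D); apply: cvgMl_tmp; apply: cvg_expr.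
  by rewrite gtr0_norm.
have /cvgrPdist_le/(_ e e0)[N0 _ hN0] := lim0.
(* The partial sum of length [N] is the one compared with the approximant of exponent
   [N - n - 1]. *)
exists (n + N0).+1 => N NN0.
have -> : N = (n + (N - n.+1)).+1 by rewrite -addSn subnKC // (leq_trans _ NN0) // ltnS leq_addr.
apply: le_trans (delta_expansion_dist n _ m) _.
have := hN0 (N - n.+1)%N; rewrite /= sub0r normrN => h.
apply: le_trans (ler_norm _) (h _).
by rewrite leq_subRL ?addSn // (leq_trans _ NN0) // ltnS leq_addr.
Qed.

(** For sequences cut off at [N], completeness gives the identity by finite linearity. The limit is
    taken by dominated convergence with ratio [A B / (a p)], which constrains the product of the
    rates and not each of them by an l2 condition. *)
Lemma jacobi_parseval A B Ca Cb u v (SA SB : nat -> R) (l : R) :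
  0 <= A -> A < 1 -> 0 <= B -> B < 1 -> A * B < a * p ->
  (forall n, `|u n| <= Ca * A ^+ n) -> (forall n, `|v n| <= Cb * B ^+ n) ->
  (forall x, has_sum (fun n => u n * jac x n) (SA x)) ->
  (forall x, has_sum (fun n => v n * jac x n) (SB x)) ->
  has_sum (fun n => u n * v n / w n) l ->
  has_sum (fun x => W x * (SA x * SB x)) l.
Proof.
(* [majorant_gen_le] needs [A] and [B] to be at least [a p]; enlarging them keeps
   [A B < a p] because [a p < 1]. *)
wlog : A B / a * p <= A /\ a * p <= B.
  move=> wl A0 A1 B0 B1 AB uC vC hA hB.
  have Ca0 : 0 <= Ca by have := uC 0%N; rewrite expr0 mulr1; apply: le_trans.
  have Cb0 : 0 <= Cb by have := vC 0%N; rewrite expr0 mulr1; apply: le_trans.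
  apply: (wl (Num.max A (a * p)) (Num.max B (a * p))) => //.
  - by rewrite !le_max !lexx !orbT.
  - by rewrite le_max A0.
  - by rewrite gt_max A1.
  - by rewrite le_max B0.
  - by rewrite gt_max B1.
  - by case: (leP A (a * p)) => _; case: (leP B (a * p)) => _ //; rewrite ?gtr_pMr ?gtr_pMl.
  - move=> n; apply: le_trans (uC n) _; apply: ler_wpM2l => //.
    by rewrite lerXn2r ?nnegrE ?le_max ?A0 ?lexx.
  - move=> n; apply: le_trans (vC n) _; apply: ler_wpM2l => //.
    by rewrite lerXn2r ?nnegrE ?le_max ?B0 ?lexx.
move=> [apA apB] A0 A1 B0 B1 AB uC vC hA hB hl.
have Ca0 : 0 <= Ca by have := uC 0%N; rewrite expr0 mulr1; apply: le_trans.
have Cb0 : 0 <= Cb by have := vC 0%N; rewrite expr0 mulr1; apply: le_trans.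
pose E := Ca * K2 * mb A; pose E' := Cb * K2 * mb B.
have E0 : 0 <= E.
  by apply: mulr_ge0 (ltW (majorant_bound_gt0 p_lt1 A1)); apply: mulr_ge0 (ltW K2_gt0).
have E'0 : 0 <= E'.
  by apply: mulr_ge0 (ltW (majorant_bound_gt0 p_lt1 B1)); apply: mulr_ge0 (ltW K2_gt0).
have r1 : `|A * B / (a * p)| < 1.
  by rewrite ger0_norm ?divr_ge0 ?mulr_ge0 ?(ltW a_gt0) ?(ltW p_gt0) // ltr_pdivrMr // mul1r.
apply: (@tannery _ (fun N x => W x * ((\sum_(n < N) u n * jac x n) * (\sum_(n < N) v n * jac x n)))
  (fun x => W x * (SA x * SB x)) _ (fun N => \sum_(n < N) u n * v n / w n) l _ _
  (has_sum_geometric (c := E * E' * K4) r1)).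
- move=> N x; rewrite normrM (gtr0_norm (W_gt0 _)) normrM.
  apply: le_trans (_ : W x * ((E * (A ^+ x * maj x)) * (E' * (B ^+ x * maj x))) <= _).
    rewrite ler_pM2l //; apply: ler_pM => //.
      apply: le_trans (ler_norm_sum _ _ _) _; exact: jacobi_partial_sum_le.
    apply: le_trans (ler_norm_sum _ _ _) _; exact: jacobi_partial_sum_le.
  have := dual_weight_majorant_le p_gt0 p_lt1 a_gt0 ap_lt1 c_gt0 c_lt1 x A0 B0.
  move=> /(ler_wpM2l (mulr_ge0 E0 E'0)); rewrite [_ * (K4 * _)]mulrA; apply: le_trans.
  by rewrite le_eqVlt; apply/orP; left; apply/eqP; ring.
- move=> x; apply: cvgMl_tmp; apply: cvgM.
    by have := hA x; rewrite /has_sum seriesEord.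
  by have := hB x; rewrite /has_sum seriesEord.
- move=> N.
  have h := @has_sum_sum _ N (fun n x => \sum_(m < N) (u n * v m) * (W x * jac x n * jac x m))
     (fun n => \sum_(m < N) (u n * v m) * ((n == m)%:R / w n))
     (fun n _ => @has_sum_sum _ N (fun m x => (u n * v m) * (W x * jac x n * jac x m))
       _ (fun m _ => has_sumZ (c := u n * v m) (@jacobi_complete n m))).
  move: h; congr has_sum.
    apply/funext => x; rewrite mulr_suml mulr_sumr; apply: eq_bigr => n _.
    by rewrite mulr_sumr mulr_sumr; apply: eq_bigr => m _; ring.
  apply: eq_bigr => n _; rewrite (bigD1 n) //= eqxx div1r big1 ?addr0 // => m mn.
  by rewrite (_ : (n == m :> nat) = false) ?mul0r ?mulr0 //; apply/negbTE; rewrite eq_sym.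
- by move: hl; rewrite /has_sum seriesEord.
Qed.

End LittleQJacobiCompleteness.

(** * The functions of the theorem in terms of [p = q^2], [a = q^(2s)] and [c = q^(2k)] *)

Section Identification.
Context {R : realType}.
Variable q : R.
Hypotheses (q_gt0 : 0 < q) (q_lt1 : q < 1).
Implicit Types (r s t k : R) (n x y j : nat).

Lemma powR_expR r : q `^ r = expR (r * ln q).
Proof. by rewrite /powR gt_eqF. Qed.

Lemma powR_add r s : q `^ (r + s) = q `^ r * q `^ s.
Proof. by rewrite !powR_expR mulrDl expRD. Qed.

Lemma powR_nat r n : q `^ (n%:R * r) = q `^ r ^+ n.
Proof. by rewrite !powR_expR -mulrA expRM_natl. Qed.

Lemma powR_opp r : q `^ (- r) = (q `^ r)^-1.
Proof. by rewrite !powR_expR mulNr expRN. Qed.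

Lemma powR_pos r : 0 < q `^ r.
Proof. exact: powR_gt0. Qed.

Lemma powR_exp n : q `^ n%:R = q ^+ n.
Proof. by rewrite powR_mulrn // ltW. Qed.

Lemma powR_lt1 r : 0 < r -> q `^ r < 1.
Proof. by move=> r0; rewrite powR_expR expR_lt1 pmulr_rlt0 // ln_lt0 // q_gt0. Qed.

Let p : R := q ^+ 2.
Definition qa s : R := q `^ (2 * s).

Lemma q2X n : p ^+ n = q `^ (2 * n%:R).
Proof. by rewrite -exprM -powR_exp natrM. Qed.

Lemma q2_gt0 : 0 < p. Proof. exact: exprn_gt0. Qed.
Lemma q2_lt1 : p < 1. Proof. by rewrite exprn_ilt1 // ltW. Qed.
Lemma qa_gt0 s : 0 < qa s. Proof. exact: powR_pos. Qed.
Lemma qaE s : qa s * p = q `^ (2 * s + 2).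
Proof. by rewrite powR_add powR_exp. Qed.
Lemma qa_mul_lt1 s : -1 < s -> qa s * p < 1.
Proof. by move=> s1; rewrite qaE powR_lt1 //; lra. Qed.
Lemma qa_lt1 k : 0 < k -> qa k < 1.
Proof. by move=> k0; rewrite powR_lt1 // mulr_gt0. Qed.

Let p_neq0 : p != 0. Proof. by rewrite gt_eqF // q2_gt0. Qed.
Let qa_neq0 s : qa s != 0. Proof. by rewrite gt_eqF // qa_gt0. Qed.

(** Factor by factor, [1 - e^-1 p^-i] is [-(1 - e p^i) / (e p^i)]. This brings the symbols in base
    [q^-2] to base [p]. *)
Lemma qpoch_inv (e : R) j : e != 0 ->
  qpoch e^-1 p^-1 j = (-1) ^+ j / (e ^+ j * \prod_(i < j) p ^+ i) * qpoch e p j.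
Proof.
move=> e0; elim: j => [|j IH]; first by rewrite !qpoch0 big_ord0 !expr0 !mulr1 divr1.
have P0 : \prod_(i < j) p ^+ i != 0 by apply/prodf_neq0 => i _; rewrite expf_neq0.
have pj0 : p ^+ j != 0 by rewrite expf_neq0.
have ej0 : e ^+ j != 0 by rewrite expf_neq0.
rewrite !qpochS IH big_ord_recr /= exprVn !exprS.
by field; rewrite P0 pj0 ej0 e0.
Qed.

(** Two symbols above and two below are inverted, so signs and triangular powers of [p] cancel. The
    remaining symbol of [phi], in [q^(2n)], is left out because it is the value of [newton j] at
    [p^n]. *)
Lemma phi_coefE s k x j : 0 < k ->
  qpoch (q ^+ (2 * x)) (q ^- 2) j * qpoch (q `^ (- 2 * x%:R - 2 * s - 2 * k)) (q ^- 2) j /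
  (qpoch (q `^ (- 2 * k)) (q ^- 2) j * qpoch (q ^- 2) (q ^- 2) j) * q ^- (2 * j) =
  jacobi_coef p (qa s) (qa k) x j.
Proof.
move=> k0.
have px0 : p ^+ x != 0 by rewrite expf_neq0.
have pj0 : p ^+ j != 0 by rewrite expf_neq0.
have -> : q `^ (- 2 * x%:R - 2 * s - 2 * k) = (qa s * qa k * p ^+ x)^-1.
  rewrite q2X -!powR_add -powR_opp; congr (_ `^ _); ring.
have -> : q `^ (- 2 * k) = (qa k)^-1 by rewrite mulNr powR_opp.
have e0 : qa s * qa k * p ^+ x != 0 by rewrite (mulf_neq0 _ px0) // mulf_neq0.
have e1 : p ^- x != 0 by rewrite invr_eq0.
rewrite !exprM -/p -{1}[p ^+ x]invrK !qpoch_inv //.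
have P0 : \prod_(i < j) p ^+ i != 0 by apply/prodf_neq0 => i _; rewrite expf_neq0.
have h1 := qpoch_neq0 q2_gt0 q2_lt1 j (qa_lt1 k0).
have h2 := qpoch_neq0 q2_gt0 q2_lt1 j q2_lt1.
have h3 : (-1) ^+ j != 0 :> R by rewrite expf_neq0 // oppr_eq0 oner_neq0.
have h4 : qa s ^+ j != 0 by rewrite expf_neq0.
have h5 : qa k ^+ j != 0 by rewrite expf_neq0.
have h6 : (p ^+ x) ^+ j != 0 by rewrite expf_neq0.
rewrite /jacobi_coef [(_ * p ^+ x) ^+ j]exprMn [(_ * qa k) ^+ j]exprMn exprVn.
by field; rewrite P0 h1 h2 h3 h4 h5 h6 pj0.
Qed.

Lemma phiE (u : R[i]) s k n x : 0 < k ->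
  phi q u s k n x = cpow q (n%:R * (s%:C - u + (k / 2 + 1 / 2)%:C)) *
    ((jacobi p (qa s) (qa k) x).[p ^+ n])%:C.
Proof.
move=> k0; rewrite /phi; congr (_ * _%:C).
rewrite horner_jacobi (@sum_ord_trunc _
  (fun j => jacobi_coef p (qa s) (qa k) x j * qpoch (p ^+ n) p^-1 j) (minn n x).+1).
- apply: eq_bigr => j _; rewrite -phi_coefE // [q ^+ (2 * n)]exprM -/p.
  by set X := qpoch (p ^+ n) _ _; ring.
- by rewrite ltnS geq_minr.
- move=> j /andP[h1 h2]; rewrite qpoch_falling0 ?mulr0 ?q2_gt0 //.
  by move: h1; rewrite gtn_min => /orP[//|]; rewrite ltnNge -ltnS h2.
Qed.

Lemma WkE s k x : Wk q k x s = dual_weight p (qa s) (qa k) x.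
Proof.
have e1 (m : nat) (r : R) : q `^ (2 * m%:R + r) = p ^+ m * q `^ r.
  by rewrite powR_add q2X.
rewrite /Wk /dual_weight.
have -> : q `^ (4 * x%:R + 2 * s + 2 * k) = qa s * qa k * p ^+ (x + x).
  rewrite (_ : 4 * _ + _ + _ = 2 * (x + x)%:R + (2 * s + 2 * k)) ?natrD; last by ring.
  by rewrite -natrD e1 powR_add mulrC.
have -> : q `^ (2 * x%:R + 2 * s + 2 * k) = qa s * qa k * p ^+ x.
  by rewrite -addrA e1 powR_add mulrC.
have -> : q `^ (2 * x%:R + 2 * s + 2) = qa s * p ^+ x.+1.
  rewrite (_ : _ + 2 = 2 * x.+1%:R + 2 * s); last by rewrite -natr1; ring.
  by rewrite e1 mulrC.
have -> : q `^ (2 * x%:R + 2 * s + 2 * k + 2) = qa s * qa k * p ^+ x.+1.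
  rewrite (_ : _ + 2 = 2 * x.+1%:R + (2 * s + 2 * k)); last by rewrite -natr1; ring.
  by rewrite e1 powR_add mulrC.
have -> : q `^ (2 * x%:R * (x%:R + s)) = p ^+ (x * x) * qa s ^+ x.
  rewrite (_ : _ * _ = 2 * (x * x)%:R + x%:R * (2 * s)); last by rewrite natrM; ring.
  by rewrite e1 powR_nat.
by [].
Qed.

Lemma weightE s k n :
  weight p (qa s) (qa k) n = q `^ (n%:R * (2 * s + 2)) * (qpoch (qa k) p n / qpoch p p n).
Proof. by rewrite /weight qaE powR_nat. Qed.

End Identification.

(** * The one-variable kernel *)

Section ComplexSeries.
Local Open Scope classical_set_scope.
Local Open Scope ring_scope.
Context {R : realType}.
Implicit Types (z l : R[i]) (g : nat -> R[i]).

Lemma normc_le_ReIm z : `|z| <= (`|complex.Re z| + `|complex.Im z|)%:C.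
Proof.
case: z => x y; rewrite normc_def lecR /=.
rewrite -[leRHS]ger0_norm ?addr_ge0 // -sqrtr_sqr ler_sqrt ?sqr_ge0 //.
rewrite sqrrD !real_normK ?num_real // lerD2r lerDl.
by rewrite mulrn_wge0 // mulr_ge0.
Qed.

Lemma cgt0_real (e : R[i]) : 0 < e -> 0 < complex.Re e /\ e = (complex.Re e)%:C.
Proof. by case: e => x y; rewrite ltcE /= => /andP[/eqP -> x0]. Qed.

Lemma Re_sum (I : Type) (r : seq I) (P : pred I) (F : I -> R[i]) :
  complex.Re (\sum_(i <- r | P i) F i) = \sum_(i <- r | P i) complex.Re (F i).
Proof. exact: raddf_sum. Qed.

Lemma Im_sum (I : Type) (r : seq I) (P : pred I) (F : I -> R[i]) :
  complex.Im (\sum_(i <- r | P i) F i) = \sum_(i <- r | P i) complex.Im (F i).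
Proof. exact: raddf_sum. Qed.

Lemma Re_mul_real z z' (r : R) : complex.Re (z * z' * r%:C) =
  r * (complex.Re z * complex.Re z' - complex.Im z * complex.Im z').
Proof. by case: z => a b; case: z' => a' b' /=; rewrite mulr0 subr0 mulrC. Qed.

Lemma Im_mul_real z z' (r : R) : complex.Im (z * z' * r%:C) =
  r * (complex.Re z * complex.Im z' + complex.Im z * complex.Re z').
Proof. by case: z => a b; case: z' => a' b' /=; rewrite mulr0 add0r mulrC. Qed.

Definition has_csum g l := (series g : nat -> R[i]^o) @ \oo --> (l : R[i]^o).

Lemma has_csum_ReIm g l :
  has_sum (fun n => complex.Re (g n)) (complex.Re l) ->
  has_sum (fun n => complex.Im (g n)) (complex.Im l) -> has_csum g l.
Proof.
move=> hr hi; apply/cvgrPdist_le => e /cgt0_real[e0 ->].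
have e2 : 0 < complex.Re e / 2 by rewrite divr_gt0.
have /cvgrPdist_le/(_ _ e2)[N1 _ h1] := hr.
have /cvgrPdist_le/(_ _ e2)[N2 _ h2] := hi.
exists (maxn N1 N2) => // n /=; rewrite geq_max => /andP[n1 n2].
apply: le_trans (normc_le_ReIm _) _; rewrite lecR !raddfB /=.
rewrite [leRHS](splitr); apply: lerD.
  by have := h1 n n1; rewrite /= !seriesEnat /= Re_sum.
by have := h2 n n2; rewrite /= !seriesEnat /= Im_sum.
Qed.

End ComplexSeries.

Section QKernel.
Local Open Scope classical_set_scope.
Local Open Scope ring_scope.
Context {R : realType}.
Variable q : R.
Hypotheses (q_gt0 : 0 < q) (q_lt1 : q < 1).
Implicit Types (s t k : R) (n x y : nat) (z : R[i]).

Local Notation p := (q ^+ 2).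
Local Notation jac s k x n := ((jacobi p (qa q s) (qa q k) x).[p ^+ n]).

Let p_gt0 := q2_gt0 q_gt0.
Let p_lt1 := q2_lt1 q_gt0 q_lt1.

(** Real and imaginary part of the twist [q^(-nz)], separated so that the real Parseval identity
    applies to each. *)
Definition powRe z n : R := complex.Re (cpow q (- (n%:R * z))).
Definition powIm z n : R := complex.Im (cpow q (- (n%:R * z))).

Lemma cpowE z : cpow q z = (q `^ complex.Re z)%:C *
  (cos (complex.Im z * ln q) +i* sin (complex.Im z * ln q)).
Proof.
case: z => x y; rewrite /cpow /cexp powR_expR //=; congr (_%:C * (_ +i* _)).
- by congr expR; rewrite mulr0 subr0.
- by congr cos; rewrite mulr0 add0r.
- by congr sin; rewrite mulr0 add0r.
Qed.

Lemma cpowD z z' : cpow q (z + z') = cpow q z * cpow q z'.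
Proof.
rewrite !cpowE !raddfD /= powR_add // mulrDl cosD sinD.
by rewrite mulrACA -rmorphM; congr (_ * _); rewrite /GRing.mul /=; congr (_ +i* _); rewrite addrC.
Qed.

Lemma cpow_real (r : R) : cpow q r%:C = (q `^ r)%:C.
Proof. by rewrite cpowE /= mul0r cos0 sin0 mulr1. Qed.

Lemma natC n : (n%:R : R[i]) = (n%:R : R)%:C.
Proof. by rewrite rmorph_nat. Qed.

Lemma cpow_nat_le z n : `|powRe z n| <= (q `^ (- complex.Re z)) ^+ n /\
  `|powIm z n| <= (q `^ (- complex.Re z)) ^+ n.
Proof.
rewrite /powRe /powIm cpowE; case: z => x y /=.
rewrite natC /= !mul0r !subr0 !addr0 -powR_nat // mulrN.
have h := powR_pos q_gt0 (- (n%:R * x)).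
split; rewrite normrM (gtr0_norm h) ler_piMr ?(ltW h) //.
  by rewrite cos_max.
by rewrite sin_max.
Qed.

Lemma powReIm_inverse z n :
  powRe z n * powRe (- z) n - powIm z n * powIm (- z) n = 1 /\
  powRe z n * powIm (- z) n + powIm z n * powRe (- z) n = 0.
Proof.
have : cpow q (- (n%:R * z)) * cpow q (- (n%:R * - z)) = 1.
  by rewrite -cpowD mulrN opprK addNr -[0]/(0%:C) cpow_real powRr0.
rewrite /powRe /powIm; case: (cpow _ _) => x1 y1; case: (cpow _ _) => x2 y2 /= [-> h].
by split=> //; rewrite -h addrC [y1 * _]mulrC.
Qed.

(* [coupling s t k x y n] is [phi_{0,s}(n,x) phi_{0,t}(n,y) w_k(n)]; the factor
   [cpow q (- (n z))], [z = v + 1], accounts for the parameters [1] and [v]. *)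
Definition half_coupling s t k y n : R :=
  q `^ (n%:R * (s + t + 2)) * (qpoch (qa q k) p n / qpoch p p n) * jac t k y n.

Definition coupling s t k x y n : R := half_coupling s t k y n * jac s k x n.

Lemma couplingC s t k x y n : coupling s t k x y n = coupling t s k y x n.
Proof. by rewrite /coupling /half_coupling [s + t]addrC mulrAC. Qed.

Definition couplingsum s t k x y : R := limn (series (coupling s t k x y)).

(** The kernel [K_z]. Being defined by [limn], it is total; its two parts are known to be sums only
    for [Re z < s + t + 2]. *)
Definition qkernel s t k z x y : R[i] :=
  limn (series (fun n => powRe z n * coupling s t k x y n)) +i*
  limn (series (fun n => powIm z n * coupling s t k x y n)).

Lemma jacobi_bounded t k y : exists2 D, 0 <= D & forall n, `|jac t k y n| <= D.
Proof.
exists (\sum_(j < y.+1) `|jacobi_coef p (qa q t) (qa q k) y j|).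
  exact: sumr_ge0.
move=> n; rewrite horner_jacobi; apply: le_trans (ler_norm_sum _ _ _) _.
apply: ler_sum => j _; rewrite normrM ler_piMr //.
exact: qpoch_falling_norm_le1.
Qed.

Lemma half_coupling_le s t k y : 0 < k ->
  exists2 D, 0 <= D & forall n, `|half_coupling s t k y n| <= D * (q `^ (s + t + 2)) ^+ n.
Proof.
move=> k0; have [D D0 hD] := jacobi_bounded t k y.
have C0 : 0 <= (qpoch_inf p p)^-1 by rewrite invr_ge0 ltW // qpoch_inf_gt0 // ltW.
exists ((qpoch_inf p p)^-1 * D); first exact: mulr_ge0.
move=> n.
have /andP[h1 h2] := qpoch_ratio_le p_gt0 p_lt1 n (ltW (qa_gt0 q_gt0 k)) (qa_lt1 q_gt0 q_lt1 k0).
have h3 : 0 < q `^ (s + t + 2) ^+ n by rewrite exprn_gt0 // powR_pos.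
rewrite /half_coupling powR_nat // normrM normrM (gtr0_norm h3) (ger0_norm h1).
rewrite -mulrA [leRHS]mulrC ler_pM2l //.
exact: ler_pM h1 _ h2 (hD n).
Qed.

Lemma twisted_half_coupling_le (f : nat -> R) r s t k y : 0 < k ->
  (forall n, `|f n| <= (q `^ r) ^+ n) ->
  exists2 D, 0 <= D & forall n, `|f n * half_coupling s t k y n| <= D * (q `^ (s + t + 2 + r)) ^+ n.
Proof.
move=> k0 hf; have [D D0 hD] := half_coupling_le s t y k0; exists D => // n.
rewrite powR_add // exprMn [leRHS]mulrA [leRHS]mulrC normrM.
exact: ler_pM (hf n) (hD n).
Qed.

Lemma twisted_coupling_le (f : nat -> R) r s t k x y : 0 < k ->
  (forall n, `|f n| <= (q `^ r) ^+ n) ->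
  exists D, forall n, `|f n * coupling s t k x y n| <= D * (q `^ (s + t + 2 + r)) ^+ n.
Proof.
move=> k0 hf; have [D D0 hD] := twisted_half_coupling_le s t y k0 hf.
have [D' D'0 hD'] := jacobi_bounded s k x.
exists (D' * D) => n; rewrite /coupling mulrA normrM mulrC -[leRHS]mulrA.
exact: ler_pM (hD' n) (hD n).
Qed.

Lemma coupling_sum_exists (f : nat -> R) r s t k x y : 0 < k -> 0 < s + t + 2 + r ->
  (forall n, `|f n| <= (q `^ r) ^+ n) ->
  exists l, has_sum (fun n => f n * coupling s t k x y n) l.
Proof.
move=> k0 r0 hf; have [D hD] := twisted_coupling_le s t x y k0 hf.
apply: has_sum_geometric_dominated hD; first by rewrite ltW // powR_pos.
by rewrite powR_lt1.
Qed.

Lemma limn_has_sum (u : nat -> R) : (exists l, has_sum u l) -> has_sum u (limn (series u)).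
Proof. by move=> [l h]; apply: cvgP h. Qed.

Lemma couplingsumP s t k x y : 0 < k -> 0 < s + t + 2 ->
  has_sum (coupling s t k x y) (couplingsum s t k x y).
Proof.
move=> k0 st; apply: limn_has_sum.
have [||l h] := @coupling_sum_exists (fun=> 1) 0 s t k x y k0; first by rewrite addr0.
  by move=> n; rewrite powRr0 expr1n normr1.
by exists l; apply: eq_has_sum h => n; rewrite mul1r.
Qed.

Lemma qkernel_sumP s t k z x y : 0 < k -> complex.Re z < s + t + 2 ->
  has_sum (fun n => powRe z n * coupling s t k x y n) (complex.Re (qkernel s t k z x y)) /\
  has_sum (fun n => powIm z n * coupling s t k x y n) (complex.Im (qkernel s t k z x y)).
Proof.
move=> k0 zst; have r0 : 0 < s + t + 2 + - complex.Re z by rewrite subr_gt0.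
by split; apply: limn_has_sum; apply: (coupling_sum_exists _ _ k0 r0) => n;
  have [] := cpow_nat_le z n.
Qed.

(* The weights [q^r] and [q^r'] may take one of the two sequences out of the
   l2-space of [weight]; only their product has to be summable. *)
Lemma coupling_parseval (f g : nat -> R) r r' s t t' k y y' (SA SB : nat -> R) (l : R) :
  0 < k -> -1 < s -> 0 < s + t + 2 + r -> 0 < s + t' + 2 + r' -> 0 < t + t' + 2 + r + r' ->
  (forall n, `|f n| <= (q `^ r) ^+ n) -> (forall n, `|g n| <= (q `^ r') ^+ n) ->
  (forall x, has_sum (fun n => f n * coupling s t k x y n) (SA x)) ->
  (forall x, has_sum (fun n => g n * coupling s t' k x y' n) (SB x)) ->
  has_sum (fun n => f n * g n * coupling t t' k y y' n) l ->
  has_sum (fun x => Wk q k x s * (SA x * SB x)) l.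
Proof.
move=> k0 s1 r0 r'0 rr hf hg hA hB hl.
have [D _ hD] := twisted_half_coupling_le s t y k0 hf.
have [D' _ hD'] := twisted_half_coupling_le s t' y' k0 hg.
have W x := WkE q_gt0 s k x.
apply: (eq_has_sum (fun x => congr1 (fun w => w * (SA x * SB x)) (esym (W x)))).
have [a0 a1] := (qa_gt0 q_gt0 s, qa_mul_lt1 q_gt0 q_lt1 s1).
have [c0 c1] := (qa_gt0 q_gt0 k, qa_lt1 q_gt0 q_lt1 k0).
apply: (jacobi_parseval p_gt0 p_lt1 a0 a1 c0 c1 _ _ _ _ _ hD hD').
- by rewrite ltW // powR_pos.
- by rewrite powR_lt1.
- by rewrite ltW // powR_pos.
- by rewrite powR_lt1.
(* The condition [A B < a p]: the product of the rates is [q^(2s+2)], which is [a p], times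
   [q^(t+t'+2+r+r')]. *)
- rewrite -powR_add // qaE //.
  have -> : s + t + 2 + r + (s + t' + 2 + r') = (2 * s + 2) + (t + t' + 2 + r + r').
    by ring.
  by rewrite powR_add // gtr_pMr ?powR_pos // powR_lt1.
- by move=> x; apply: eq_has_sum (hA x) => n; rewrite /coupling mulrA.
- by move=> x; apply: eq_has_sum (hB x) => n; rewrite /coupling mulrA.
apply: eq_has_sum hl => n; rewrite /coupling /half_coupling weightE //.
(* Division by the weight removes the factor [q^(n(2s+2))], and with it all dependence on [s]. *)
have e : q `^ (n%:R * (s + t + 2)) * q `^ (n%:R * (s + t' + 2)) =
    q `^ (n%:R * (2 * s + 2)) * q `^ (n%:R * (t + t' + 2)).
  by rewrite -!powR_add //; congr (_ `^ _); ring.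
have q1 := powR_pos q_gt0 (n%:R * (2 * s + 2)).
have h1 := qpoch_neq0 p_gt0 p_lt1 n p_lt1.
have h2 := qpoch_neq0 p_gt0 p_lt1 n c1.
transitivity (f n * g n * (q `^ (n%:R * (s + t + 2)) * q `^ (n%:R * (s + t' + 2))) /
   q `^ (n%:R * (2 * s + 2)) * (qpoch (qa q k) p n / qpoch p p n) * jac t k y n * jac t' k y' n).
  by rewrite e; field; rewrite h1 gt_eqF.
by field; rewrite h1 h2 gt_eqF.
Qed.

(** Here [r = - Re z] and [r' = Re z], so the growth rates cancel. Four real Parseval identities,
    one for each pair of parts, recombine through [q^(-nz) q^(nz) = 1]. *)
Lemma qkernel_orth s t t' k z y y' : 0 < k -> -1 < s -> -1 < t -> -1 < t' ->
  complex.Re z < s + t + 2 -> - complex.Re z < s + t' + 2 ->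
  has_csum (fun x => qkernel s t k z x y * qkernel s t' k (- z) x y' * (Wk q k x s)%:C)
           (couplingsum t t' k y y')%:C.
Proof.
move=> k0 s1 t1 t'1 zt zt'.
have r0 : 0 < s + t + 2 + - complex.Re z by rewrite subr_gt0.
have r'0 : 0 < s + t' + 2 + - complex.Re (- z) by rewrite raddfN /= opprK -[X in _ + X]opprK subr_gt0.
have rr : 0 < t + t' + 2 + - complex.Re z + - complex.Re (- z).
  by rewrite raddfN /= opprK subrK; lra.
have tt' : 0 < t + t' + 2 by lra.
have bRe w n : `|powRe w n| <= (q `^ (- complex.Re w)) ^+ n by have [] := cpow_nat_le w n.
have bIm w n : `|powIm w n| <= (q `^ (- complex.Re w)) ^+ n by have [] := cpow_nat_le w n.
have zt'' : complex.Re (- z) < s + t' + 2 by rewrite raddfN.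
have kR x := (qkernel_sumP x y k0 zt).1; have kI x := (qkernel_sumP x y k0 zt).2.
have kR' x := (qkernel_sumP x y' k0 zt'').1; have kI' x := (qkernel_sumP x y' k0 zt'').2.
have ex (f g : nat -> R) : (forall n, `|f n| <= (q `^ (- complex.Re z)) ^+ n) ->
    (forall n, `|g n| <= (q `^ (- complex.Re (- z))) ^+ n) ->
    exists l, has_sum (fun n => f n * g n * coupling t t' k y y' n) l.
  move=> hf hg; apply: (@coupling_sum_exists (fun n => f n * g n) 0) => //; first by rewrite addr0.
  move=> n; rewrite powRr0 expr1n normrM.
  apply: le_trans (ler_pM _ _ (hf n) (hg n)) _ => //.
  by rewrite -exprMn -powR_add // raddfN /= subrr powRr0 expr1n.
have [lRR hRR] := ex _ _ (bRe z) (bRe (- z)).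
have [lII hII] := ex _ _ (bIm z) (bIm (- z)).
have [lRI hRI] := ex _ _ (bRe z) (bIm (- z)).
have [lIR hIR] := ex _ _ (bIm z) (bRe (- z)).
have PRR := coupling_parseval k0 s1 r0 r'0 rr (bRe z) (bRe (- z)) kR kR' hRR.
have PII := coupling_parseval k0 s1 r0 r'0 rr (bIm z) (bIm (- z)) kI kI' hII.
have PRI := coupling_parseval k0 s1 r0 r'0 rr (bRe z) (bIm (- z)) kR kI' hRI.
have PIR := coupling_parseval k0 s1 r0 r'0 rr (bIm z) (bRe (- z)) kI kR' hIR.
have eR : lRR - lII = couplingsum t t' k y y'.
  have h : has_sum (coupling t t' k y y') (lRR - lII).
    apply: eq_has_sum (has_sumB hRR hII) => n.
    by rewrite -mulrBl (powReIm_inverse z n).1 mul1r.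
  exact: has_sum_unique h (couplingsumP k0 tt').
have eI : lRI + lIR = 0.
  have h : has_sum (fun=> 0) (lRI + lIR).
    apply: eq_has_sum (has_sumD hRI hIR) => n.
    by rewrite -mulrDl (powReIm_inverse z n).2 mul0r.
  exact: has_sum_unique h has_sum0.
apply: has_csum_ReIm; rewrite [X in has_sum _ X]/=.
  rewrite -eR; apply: eq_has_sum (has_sumB PRR PII) => x.
  by rewrite Re_mul_real mulrBr.
rewrite -eI; apply: eq_has_sum (has_sumD PRI PIR) => x.
by rewrite Im_mul_real mulrDr.
Qed.

Lemma couplingsum_diag t k y y' : 0 < k -> -1 < t ->
  couplingsum t t k y y' = (y == y')%:R / Wk q k y t.
Proof.
move=> k0 t1; have tt : 0 < t + t + 2 by lra.
apply: (has_sum_unique (couplingsumP k0 tt)).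
have [a0 a1] := (qa_gt0 q_gt0 t, qa_mul_lt1 q_gt0 q_lt1 t1).
have [c0 c1] := (qa_gt0 q_gt0 k, qa_lt1 q_gt0 q_lt1 k0).
rewrite WkE // eq_sym; have := @jacobi_orth _ _ _ _ p_gt0 p_lt1 a0 a1 c0 c1 y' y.
have [->|yy'] := eqVneq y' y; first last.
  rewrite !mul0r; apply: eq_has_sum => n.
  by rewrite /coupling /half_coupling weightE // (_ : t + t + 2 = 2 * t + 2) //; ring.
apply: eq_has_sum => n.
by rewrite /coupling /half_coupling weightE // (_ : t + t + 2 = 2 * t + 2) //; ring.
Qed.

End QKernel.

(** * Several variables *)

Section BoxSums.
Local Open Scope classical_set_scope.
Local Open Scope ring_scope.

Lemma cvg_bigprod (K : numFieldType) (I : Type) (r : seq I) (F : I -> nat -> K^o) (S : I -> K^o) :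
  (forall i, F i @ \oo --> S i) ->
  (fun N => \prod_(i <- r) F i N : K^o) @ \oo --> (\prod_(i <- r) S i : K^o).
Proof.
move=> h; elim: r => [|i r IH].
  rewrite big_nil (_ : (fun N => _) = fun=> 1); first exact: cvg_cst.
  by apply/funext => N; rewrite big_nil.
rewrite big_cons (_ : (fun N => _) = fun N => F i N * \prod_(j <- r) F j N).
  by apply: cvgM.
by apply/funext => N; rewrite big_cons.
Qed.

Lemma cvg_seriesZ (K : numFieldType) (c : K^o) (u : nat -> K^o) (l : K^o) :
  series u @ \oo --> l -> (series (fun n => c * u n : K^o) : nat -> K^o) @ \oo --> (c * l : K^o).
Proof.
move=> h; rewrite (_ : series _ = fun n => c * series u n); first exact: cvgMl_tmp.
by apply/funext => n; rewrite !seriesEnat /= mulr_sumr.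
Qed.

Context {R : realType}.
Variable M : nat.
Implicit Types (N : nat) (x : M.-tuple nat).

(** The cubes [{0, ..., N-1}^M] are cofinal among the finite sets of multi-indices, and over a cube
    the sum of a product factors. *)
Definition box N : seq (M.-tuple nat) :=
  map (fun f : {ffun 'I_M -> 'I_N} => [tuple nat_of_ord (f j) | j < M]) (enum {: {ffun 'I_M -> 'I_N}}).

Lemma mem_box N x : (x \in box N) = [forall j, tnth x j < N]%N.
Proof.
apply/mapP/forallP => [[f _ ->] j|xN]; first by rewrite tnth_mktuple.
exists [ffun j => Ordinal (xN j)]; first by rewrite mem_enum.
apply: eq_from_tnth => j.
by rewrite tnth_mktuple ffunE.
Qed.

Lemma box_uniq N : uniq (box N).
Proof.
rewrite map_inj_uniq ?enum_uniq // => f g /(congr1 (fun t => tnth t)) fg.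
by apply/ffunP => j; apply: val_inj; have := congr1 (fun h => h j) fg; rewrite !tnth_mktuple.
Qed.

Lemma box_sum (K : comPzSemiRingType) (F : 'I_M -> nat -> K) N :
  \sum_(x <- box N) \prod_j F j (tnth x j) = \prod_j \sum_(m < N) F j m.
Proof.
rewrite big_map big_enum /= bigA_distr_bigA; apply: eq_bigr => f _.
by apply: eq_bigr => j _; rewrite tnth_mktuple.
Qed.

Lemma box_subset N N' x : (N <= N')%N -> x \in box N -> x \in box N'.
Proof.
by move=> NN'; rewrite !mem_box => /forallP h; apply/forallP => j; exact: leq_trans (h j) NN'.
Qed.

Lemma mem_box_exists (s : seq (M.-tuple nat)) N : exists2 N', (N <= N')%N & {subset s <= box N'}.
Proof.
elim: s => [|x s [N' NN' h]]; first by exists N.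
pose m := \max_(j < M) tnth x j.
exists (maxn N' m.+1) => [|y]; first by rewrite leq_max NN'.
rewrite inE => /predU1P[->|/h]; last by apply: box_subset; rewrite leq_maxl.
rewrite mem_box; apply/forallP => j; rewrite leq_max ltnS orbC.
by rewrite (leq_bigmax (F := fun j => tnth x j) j).
Qed.

Lemma sum_fset_box (V : zmodType) (f : M.-tuple nat -> V) (B : {fset M.-tuple nat}) N :
  {subset B <= box N} -> summability.partial_sum f B = \sum_(x <- box N | x \in B) f x.
Proof.
move=> BN; rewrite /summability.partial_sum -(big_seq_fsetE _ _ xpredT) /= -[RHS]big_filter.
apply: perm_big; apply: uniq_perm; rewrite ?fset_uniq ?filter_uniq ?box_uniq // => x.
by rewrite mem_filter; case: (boolP (x \in B)) => // /BN ->.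
Qed.

(** A finite set [B] containing [box N] is compared with a larger cube containing [B]: the sums
    differ by at most the mass of the majorant outside [box N], while the sum over the cube is
    already close to the product. *)
Lemma sum_prod_tuple (F : 'I_M -> nat -> R[i]) (G : 'I_M -> nat -> R)
    (S : 'I_M -> R[i]) (T : 'I_M -> R) :
  (forall j n, `|F j n| <= (G j n)%:C) ->
  (forall j, has_sum (G j) (T j)) -> (forall j, has_csum (F j) (S j)) ->
  summability.sum (fun x : M.-tuple nat => \prod_j F j (tnth x j) : R[i]^o) = \prod_j S j.
Proof.
move=> FG GT FS.
have totallyP := @summability.totally_filter (M.-tuple nat).
apply: cvg_lim; first exact: norm_hausdorff.
pose f x := \prod_j F j (tnth x j); pose g x := \prod_j G j (tnth x j).
have G0 j n : 0 <= G j n by rewrite -lecR; apply: le_trans (FG j n); exact: normr_ge0.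
have fg x : `|f x| <= (g x)%:C.
  rewrite normr_prod rmorph_prod; apply: ler_prod => j _.
  by rewrite normr_ge0 FG.
have g0 x : 0 <= g x by exact: prodr_ge0.
apply/cvgrPdist_le => e /cgt0_real[]; set e' := complex.Re e => e'0 ->.
have e2 : 0 < e' / 2 by rewrite divr_gt0.
have e2C : 0 < (e' / 2)%:C by rewrite ltcR.
have limF : (fun N => \sum_(x <- box N) f x : R[i]^o) @ \oo --> (\prod_j S j : R[i]^o).
  rewrite (_ : (fun N => _) = fun N => \prod_j series (F j) N).
    exact: (@cvg_bigprod R[i] _ _ (fun j => series (F j)) S FS).
  by apply/funext => N; rewrite box_sum; apply: eq_bigr => j _; rewrite seriesEord.
have limG : (fun N => \sum_(x <- box N) g x : R^o) @ \oo --> (\prod_j T j : R^o).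
  rewrite (_ : (fun N => _) = fun N => \prod_j series (G j) N).
    exact: (@cvg_bigprod R _ _ (fun j => series (G j)) T GT).
  by apply/funext => N; rewrite box_sum; apply: eq_bigr => j _; rewrite seriesEord.
have /cvgrPdist_le/(_ _ e2C)[N1 _ h1] := limF.
have /cvgrPdist_le/(_ _ e2)[N2 _ h2] := limG.
pose N := maxn N1 N2.
have {h2} h2 : \prod_j T j - \sum_(x <- box N) g x <= e' / 2.
  by apply: le_trans (ler_norm _) _; apply: h2; rewrite /= leq_maxr.
exists [fset x in box N]%fset => // B /= NB.
have [N' NN' BN'] := mem_box_exists B N.
rewrite (sum_fset_box _ BN').
have gN' : \sum_(x <- box N') g x <= \prod_j T j.
  rewrite box_sum; apply: ler_prod => j _; rewrite sumr_ge0 //=.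
  by apply: has_sum_partial_le (GT j) => n.
have gsplit : \sum_(x <- box N') g x =
    \sum_(x <- box N' | x \in box N) g x + \sum_(x <- box N' | x \notin box N) g x.
  by rewrite (bigID (mem (box N))).
have gN : \sum_(x <- box N' | x \in box N) g x = \sum_(x <- box N) g x.
  rewrite -big_filter; apply: perm_big; apply: uniq_perm; rewrite ?filter_uniq ?box_uniq // => x.
  by rewrite mem_filter; case: (boolP (x \in box N)) => // /(box_subset NN') ->.
have diff : `|\sum_(x <- box N') f x - \sum_(x <- box N' | x \in B) f x| <= (e' / 2)%:C.
  rewrite (bigID (fun x => x \in B)) /= [X in `|X - _|]addrC addrK.
  apply: le_trans (ler_norm_sum _ _ _) _.
  apply: le_trans (_ : (\sum_(x <- box N' | x \notin B) g x)%:C <= _).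
    by rewrite rmorph_sum; apply: ler_sum => x _; exact: fg.
  rewrite lecR; apply: le_trans h2; apply: le_trans (_ : _ <= \sum_(x <- box N' | x \notin box N) g x) _.
    rewrite big_mkcond [leRHS]big_mkcond; apply: ler_sum => x _.
    case: ifP => [xB|_]; last by case: ifP.
    by rewrite ifT //; apply: contra xB => xN; apply: (fsubsetP NB); rewrite !inE.
  by rewrite -gN; lra.
rewrite -[X in _ <= X%:C](addrNK (e' / 2)) (_ : e' - e' / 2 = e' / 2); last by lra.
rewrite -[X in `|X - _|](subrK (\sum_(x <- box N') f x)) -addrA rmorphD.
apply: le_trans (ler_normD _ _) _; apply: lerD diff.
by apply: h1 => /=; rewrite (leq_trans _ NN') // leq_maxl.
Qed.

End BoxSums.

(** * Iterated sums of products along the heights *)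

Section IteratedSums.
Local Open Scope ring_scope.
Context {R : realType}.

Lemma is_itersumZ M (c : R[i]) (f : M.-tuple nat -> R[i]) l :
  is_itersum f l -> is_itersum (fun x => c * f x) (c * l).
Proof.
elim: M f l => [|M IH] f l /=; first by move=> ->.
case=> g hg hl; exists (fun a => c * g a); first by move=> a; exact: IH.
exact: (@cvg_seriesZ R[i]).
Qed.

Lemma height0 M (k : 'I_M -> R) y t : height k y t 0 = t.
Proof. by rewrite /height big_pred0 ?addr0. Qed.

Lemma height_cons M (k : 'I_M.+1 -> R) a (x : M.-tuple nat) t j :
  height k [tuple of a :: x] t j.+1 =
  height (fun i => k (lift ord0 i)) x (t + (2 * a%:R + k ord0)) j.
Proof.
rewrite /height big_mkcond big_ord_recl /= tnth0 addrA; congr (_ + _).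
by rewrite [RHS]big_mkcond; apply: eq_bigr => i _; rewrite tnthS.
Qed.

Lemma height_ge M (k : 'I_M -> R) y t j : (forall i, 0 < k i) -> t <= height k y t j.
Proof.
move=> k0; rewrite lerDl; apply: sumr_ge0 => i _.
by rewrite addr_ge0 ?mulr_ge0 // ltW.
Qed.

(* The one-variable sum Q does not depend on s, which is why the inner sums,
   whose s depends on the outer summation variables, can be pulled out. *)
Lemma is_itersum_heights (admissible : R -> R -> R -> Prop)
    (A : R -> R -> R -> R -> nat -> nat -> nat -> R[i]) (Q : R -> R -> R -> nat -> nat -> R[i]) :
  (forall s t t' s1 t1 t'1, admissible s t t' -> s <= s1 -> t <= t1 -> t' <= t'1 ->
     admissible s1 t1 t'1) ->
  (forall s t t' k y y', admissible s t t' -> 0 < k ->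
     has_csum (fun x => A s t t' k x y y') (Q t t' k y y')) ->
  forall M (k : 'I_M -> R) s t t' (y y' : M.-tuple nat),
  (forall i, 0 < k i) -> admissible s t t' ->
  is_itersum (fun x => \prod_(j < M) A (height k x s j) (height k y t j) (height k y' t' j) (k j)
                                 (tnth x j) (tnth y j) (tnth y' j))
    (\prod_(j < M) Q (height k y t j) (height k y' t' j) (k j) (tnth y j) (tnth y' j)).
Proof.
move=> mono hA; elim=> [|M IH] k s t t' y y' k0 adm; first by rewrite /= !big_ord0.
case/tupleP: y => b y; case/tupleP: y' => b' y'.
set k' := fun i => k (lift ord0 i).
have step u n : u <= u + (2 * n%:R + k ord0).
  by rewrite lerDl addr_ge0 ?mulr_ge0 // ltW.
pose q := \prod_(j < M) Q (height k' y (t + (2 * b%:R + k ord0)) j)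
   (height k' y' (t' + (2 * b'%:R + k ord0)) j) (k' j) (tnth y j) (tnth y' j).
exists (fun a => A s t t' (k ord0) a b b' * q).
  move=> a.
  (* Heights only increase, so the remaining coordinates start from admissible parameters for every
     value [a] of the first one. *)
  have adm' : admissible (s + (2 * a%:R + k ord0)) (t + (2 * b%:R + k ord0))
      (t' + (2 * b'%:R + k ord0)) by apply: mono adm _ _ _.
  have h := is_itersumZ (A s t t' (k ord0) a b b')
    (IH k' _ _ _ y y' (fun i => k0 (lift ord0 i)) adm').
  move: h; congr is_itersum; apply/funext => x.
  rewrite big_ord_recl !height0 !tnth0; congr (_ * _); apply: eq_bigr => j _.
  by rewrite /bump /= ?add1n !height_cons !tnthS.
rewrite big_ord_recl !height0 !tnth0 mulrC.
rewrite (_ : \prod_(i < M) _ = q); last first.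
  by apply: eq_bigr => j _; rewrite /bump /= ?add1n !height_cons !tnthS.
rewrite (_ : (fun a => _) = fun a => q * A s t t' (k ord0) a b b'); last first.
  by apply/funext => a; rewrite mulrC.
exact: (@cvg_seriesZ R[i] q _ _ (hA s t t' (k ord0) b b' adm (k0 ord0))).
Qed.

End IteratedSums.

(** * Factorisation of the multivariate kernel and biorthogonality *)

Section MultivariateKernel.
Context {R : realType}.
Variable q : R.
Hypotheses (q_gt0 : 0 < q) (q_lt1 : q < 1).
Implicit Types (s t k : R) (n x y : nat) (z v : R[i]).

Lemma qkernel_sym s t k z x y : qkernel q s t k z x y = qkernel q t s k z y x.
Proof.
by rewrite /qkernel; congr (limn (series _) +i* limn (series _));
  apply/funext => n; rewrite couplingC.
Qed.

(** The couplings are real, so conjugation acts on the twist [q^(-nz)] alone. *)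
Lemma qkernel_conj s t k z x y : 0 < k -> complex.Re z < s + t + 2 ->
  (qkernel q s t k z^* x y)^* = qkernel q s t k z x y.
Proof.
move=> k0 zst.
have zst' : complex.Re z^* < s + t + 2 by case: (z) zst.
have h n : powRe q z^* n = powRe q z n /\ powIm q z^* n = - powIm q z n.
  rewrite /powRe /powIm !cpowE // natC; case: (z) => a b /=.
  rewrite !mul0r !subr0 !addr0 !(mulrN, mulNr, opprK, sinN, cosN).
  by split; ring.
have [h1 h2] := qkernel_sumP q_gt0 q_lt1 x y k0 zst.
have [h3 h4] := qkernel_sumP q_gt0 q_lt1 x y k0 zst'.
have e1 : complex.Re (qkernel q s t k z^* x y) = complex.Re (qkernel q s t k z x y).
  by apply: has_sum_unique h3 _; apply: eq_has_sum h1 => n; rewrite (h n).1.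
have e2 : complex.Im (qkernel q s t k z^* x y) = - complex.Im (qkernel q s t k z x y).
  rewrite -mulN1r; apply: has_sum_unique h4 _.
  by apply: eq_has_sum (has_sumZ (c := -1) h2) => n; rewrite (h n).2 mulN1r mulNr.
by move: e1 e2; case: (qkernel _ _ _ _ _ _ _) => a b; case: (qkernel _ _ _ _ _ _ _) => a' b' /= -> ->;
  rewrite opprK.
Qed.

(** The exponents of the two [phi] and of [wk] add up to [n] times [(s + t + 2) - (v + 1)]; the
    contributions of [k] cancel. *)
Lemma qkernel_termE s t k v x y n : 0 < k ->
  phi q 1 s k n x * phi q v t k n y * (wk q k n)%:C =
  cpow q (- (n%:R * (v + 1))) * (coupling q s t k x y n)%:C.
Proof.
move=> k0; rewrite !phiE // /wk /coupling /half_coupling.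
move: ((jacobi _ _ _ x).[_]) ((jacobi _ _ _ y).[_]) (qpoch _ _ n / _) => j1 j2 r.
rewrite !rmorphM /= -!cpow_real //.
transitivity (cpow q (n%:R * (s%:C - 1 + (k / 2 + 1 / 2)%:C)) *
   cpow q (n%:R * (t%:C - v + (k / 2 + 1 / 2)%:C)) * cpow q (- n%:R * (k - 1))%:C *
   (r%:C * j1%:C * j2%:C)); first by ring.
transitivity (cpow q (- (n%:R * (v + 1))) * cpow q (n%:R * (s + t + 2))%:C *
   (r%:C * j1%:C * j2%:C)); last by ring.
rewrite -!cpowD //; congr (cpow _ _ * _).
rewrite !(rmorphM, rmorphD, rmorphB, rmorphN, rmorph1, fmorphV, rmorph_nat) /=.
by field.
Qed.

(** In every coordinate the terms have a geometric majorant of ratio [q^(E j)], with [E j > 0]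
    because heights are at least [s] and [t]. The unordered sum therefore factors. *)
Lemma Pr_qkernel M (k : 'I_M -> R) (x y : M.-tuple nat) s t v : (forall j, 0 < k j) ->
  complex.Re v + 1 < 2 + s + t ->
  Pr q x y s t v k = \prod_(j < M) qkernel q (height k x s j) (height k y t j) (k j) (v + 1)
                                (tnth x j) (tnth y j).
Proof.
move=> k0 vst.
pose F (j : 'I_M) n := cpow q (- (n%:R * (v + 1))) *
  (coupling q (height k x s j) (height k y t j) (k j) (tnth x j) (tnth y j) n)%:C.
rewrite /Pr (_ : (fun n : M.-tuple nat => _) = fun n : M.-tuple nat => \prod_j F j (tnth n j)); last first.
  apply/funext => n; rewrite /Phi /wvec rmorph_prod -!big_split /=.
  by apply: eq_bigr => j _; rewrite qkernel_termE.
pose r := - complex.Re (v + 1).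
pose E (j : 'I_M) := height k x s j + height k y t j + 2 + r.
have hst j : complex.Re (v + 1) < height k x s j + height k y t j + 2.
  have h1 := height_ge x s j k0; have h2 := height_ge y t j k0.
  by rewrite raddfD /=; lra.
have bnd j : exists D, forall n, `|F j n| <= (D * q `^ E j ^+ n)%:C.
  have [D hD] := twisted_coupling_le q_gt0 q_lt1 (height k x s j) (height k y t j)
    (tnth x j) (tnth y j) (k0 j) (fun n => (cpow_nat_le q_gt0 (v + 1) n).1).
  have [D' hD'] := twisted_coupling_le q_gt0 q_lt1 (height k x s j) (height k y t j)
    (tnth x j) (tnth y j) (k0 j) (fun n => (cpow_nat_le q_gt0 (v + 1) n).2).
  exists (D + D') => n; apply: le_trans (normc_le_ReIm _) _.
  rewrite lecR mulrDl; apply: lerD.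
    apply: le_trans (hD n); rewrite /F /powRe; case: (cpow _ _) => a b /=.
    by rewrite mulr0 subr0.
  apply: le_trans (hD' n); rewrite /F /powIm; case: (cpow _ _) => a b /=.
  by rewrite mulr0 add0r.
have [D hD] := choice bnd.
apply: (@sum_prod_tuple _ _ F (fun j n => D j * q `^ E j ^+ n) _ (fun j => D j / (1 - q `^ E j))) => // j.
  apply: has_sum_geometric; rewrite gtr0_norm ?powR_pos // powR_lt1 //.
  by rewrite /E /r subr_gt0.
have [hR hI] := qkernel_sumP q_gt0 q_lt1 (tnth x j) (tnth y j) (k0 j) (hst j).
apply: has_csum_ReIm.
  apply: eq_has_sum hR => n; rewrite /F /powRe; case: (cpow _ _) => a b /=.
  by rewrite mulr0 subr0.
apply: eq_has_sum hI => n; rewrite /F /powIm; case: (cpow _ _) => a b /=.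
by rewrite mulr0 add0r.
Qed.

(** The parameters 1 and [v] are attached to different variables in the definition, but the kernel
    depends only on their sum, which makes the exchange possible. *)
Lemma Pr_sym M (k : 'I_M -> R) (x y : M.-tuple nat) s t v : (forall j, 0 < k j) ->
  complex.Re v + 1 < 2 + s + t -> Pr q x y s t v k = Pr q y x t s v k.
Proof.
move=> k0 vst; rewrite !Pr_qkernel //; last by rewrite -addrA [t + s]addrC addrA.
by apply: eq_bigr => j _; rewrite qkernel_sym.
Qed.

Lemma prod_couplingsum M (k : 'I_M -> R) t (y y' : M.-tuple nat) :
  (forall j, 0 < k j) -> -1 < t ->
  \prod_(j < M) (couplingsum q (height k y t j) (height k y' t j) (k j)
                   (tnth y j) (tnth y' j))%:C = (y == y')%:R / (Wvec q k y t)%:C.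
Proof.
move=> k0 t1.
have ht (j : nat) : -1 < height k y t j by apply: lt_le_trans t1 (height_ge _ _ _ k0).
have [<-|yy'] := eqVneq y y'.
  rewrite div1r /Wvec rmorph_prod /= -prodfV; apply: eq_bigr => j _.
  by rewrite couplingsum_diag // eqxx div1r fmorphV.
have [j0 hj0] : exists j, tnth y j != tnth y' j.
  apply/existsP; apply: contraNT yy'; rewrite negb_exists => /forallP h.
  by apply/eqP/eq_from_tnth => j; have := h j; rewrite negbK => /eqP.
case: (@arg_minnP _ j0 (fun j => tnth y j != tnth y' j) val hj0) => j hj hmin.
rewrite mul0r (bigD1 j) //= (_ : height k y' t j = height k y t j).
  by rewrite couplingsum_diag // (negbTE hj) mul0r mul0r.
congr (_ + _); apply: eq_bigr => i ij; congr (_ * _%:R + _).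
apply/eqP; rewrite eq_sym; apply: contraLR ij; rewrite -leqNgt; exact: hmin.
Qed.

Lemma Pr_biorthogonal M (k : 'I_M -> R) s t v (y y' : M.-tuple nat) :
  (forall j, 0 < k j) -> -1 < s -> -1 < t -> `|complex.Re v + 1| < 2 + s + t ->
  is_itersum
    (fun x : M.-tuple nat =>
       Pr q x y s t v k * (Pr q x y' s t (- v^* - 2) k)^* * (Wvec q k x s)%:C)
    ((y == y')%:R / (Wvec q k y t)%:C).
Proof.
move=> k0 s1 t1; rewrite ltr_norml => /andP[v1 v2].
pose z := v + 1.
have zE : complex.Re z = complex.Re v + 1 by rewrite /z raddfD.
(* The origin of [- v^* - 2]: shifted by 1 it is the conjugate of [- z], so conjugating the second
   kernel produces [K_{-z}]. *)
have v'E : - v^* - 2 + 1 = (- z)^*.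
  by rewrite /z; case: (v) => a b; apply/eqP; rewrite eq_complex /=; apply/andP; split; apply/eqP; ring.
have v'Re : complex.Re (- v^* - 2) + 1 = - complex.Re z.
  by rewrite zE; case: (v) => a b /=; ring.
(* The last two conditions are the convergence of [K_z] at [(s, t)] and of [K_{-z}] at [(s, t')].
   The parameters [t] and [t'] agree at the start and may separate after a coordinate where [y] and
   [y'] differ. *)
pose admissible s t t' := [/\ -1 < s, -1 < t, -1 < t',
  complex.Re z < s + t + 2 & - complex.Re z < s + t' + 2].
pose A s t t' k x y y' := qkernel q s t k z x y * qkernel q s t' k (- z) x y' * (Wk q k x s)%:C.
pose Q t t' k y y' := (couplingsum q t t' k y y')%:C.
have mono a b c a1 b1 c1 : admissible a b c -> a <= a1 -> b <= b1 -> c <= c1 -> admissible a1 b1 c1.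
  by move=> [h1 h2 h3 h4 h5] aa bb cc; split; lra.
have adm : admissible s t t by split=> //; rewrite zE; lra.
have hA a b c k1 n n' : admissible a b c -> 0 < k1 ->
    has_csum (fun x => A a b c k1 x n n') (Q b c k1 n n').
  by move=> [h1 h2 h3 h4 h5] k1_gt0; apply: qkernel_orth.
have := is_itersum_heights mono hA y y' k0 adm.
rewrite prod_couplingsum //; congr is_itersum; apply/funext => x.
rewrite !Pr_qkernel //; last by rewrite v'Re zE; lra.
rewrite /Wvec !rmorph_prod /= -!big_split /=; apply: eq_bigr => j _.
rewrite v'E /A; congr (_ * _ * _); apply: esym; apply: qkernel_conj => //.
have h1 := height_ge x s j k0; have h2 := height_ge y' t j k0.
by rewrite raddfN /= zE; lra.
Qed.

End MultivariateKernel.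

Theorem proposition4p9 (R : realType) (q : R) (hq0 : 0 < q) (hq1 : q < 1)
  (M : nat) (hM : (1 <= M)%N) (k : 'I_M -> R) (hk : forall j, 0 < k j)
  (s t : R) (hs : -1 < s) (ht : -1 < t)
  (v : R[i]) (hv : `|complex.Re v + 1| < 2 + s + t) :
  (forall y y' : M.-tuple nat,
     is_itersum
       (fun x => Pr q x y s t v k * (Pr q x y' s t (- v^* - 2) k)^* *
                 (Wvec q k x s)%:C)
       ((y == y')%:R / (Wvec q k y t)%:C)) /\
  (forall x x' : M.-tuple nat,
     is_itersum
       (fun y => Pr q x y s t v k * (Pr q x' y s t (- v^* - 2) k)^* *
                 (Wvec q k y t)%:C)
       ((x == x')%:R / (Wvec q k x s)%:C)).
Proof.
split=> [y y'|x x']; first exact: Pr_biorthogonal.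
have hv' : `|complex.Re v + 1| < 2 + t + s by rewrite -addrA [t + s]addrC addrA.
have := Pr_biorthogonal hq0 hq1 x x' hk ht hs hv'.
move: hv; rewrite ltr_norml => /andP[v1 v2].
congr is_itersum; apply/funext => y; congr (_ * _^* * _); apply: Pr_sym => //.
  by lra.
by case: (v) v1 v2 => a b /= v1 v2; lra.
Qed.
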